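(* Let $f\in H^\sigma(\Omega)$ with $\sigma>-\tfrac12$. Then the convolutions $\chi_{ijk}*f$ defining $T_{111}f$ are continuous, and the problem $$-2\bigl(\Delta^+_x\Delta^-_x\mu_{yz}+\Delta^+_y\Delta^-_y\mu_{xz}+\Delta^+_z\Delta^-_z\mu_{xy}\bigr)u^h=T_{111}f\ \text{ in }\Omega^h,\qquad u^h=0\ \text{ on }\partial\Omega^h,$$ has a unique solution $u^h$ (a mesh function on $\bar\Omega^h$). Furthermore, $$\|u^h\|_{1,h}\le\frac{32}{30}\,\|T_{111}f\|_{-1,h}.$$
   Context: Mesh. $\Omega=(0,1)^3$. Let $0=x_0<x_1<\dots<x_{M_x}=1$, $0=y_0<\dots<y_{M_y}=1$, $0=z_0<\dots<z_{M_z}=1$ be arbitrary, with $h^x_i=x_i-x_{i-1}$, $h^y_j=y_j-y_{j-1}$, $h^z_k=z_k-z_{k-1}$, and $\hbar^x_i=\tfrac12(h^x_i+h^x_{i+1})$, $\hbar^y_j=\tfrac12(h^y_j+h^y_{j+1})$, $\hbar^z_k=\tfrac12(h^z_k+h^z_{k+1})$. $\bar\Omega^h$ is the set of points $(x_i,y_j,z_k)$, $\Omega^h=\Omega\cap\bar\Omega^h$, $\partial\Omega^h=\partial\Omega\cap\bar\Omega^h$. A mesh function is a real function on the mesh, with values $v_{ijk}=v(x_i,y_j,z_k)$. Right-hand side. For $p_{ijk}=(x_i,y_j,z_k)\in\Omega^h$ let $$\omega_{ijk}=\bigl(x_i-\tfrac12h^x_i,x_i+\tfrac12h^x_{i+1}\bigr)\times\bigl(y_j-\tfrac12h^y_j,y_j+\tfrac12h^y_{j+1}\bigr)\times\bigl(z_k-\tfrac12h^z_k,z_k+\tfrac12h^z_{k+1}\bigr),$$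 let $\chi_{ijk}(t)=\mathbf 1_{\omega_{ijk}}(p_{ijk}-t)$ for $t\in\mathbb R^3$ (so that $(\chi_{ijk}*f)(p_{ijk})=\int_{\omega_{ijk}}f$ for integrable $f$), and $$(T_{111}f)_{ijk}=\frac1{\hbar^x_i\hbar^y_j\hbar^z_k}\,(\chi_{ijk}*f)(p_{ijk}).$$ Here $f$ is extended by zero to $\mathbb R^3$; continuity of the convolution means continuity of $\chi_{ijk}*f$ on $\mathbb R^3$. Averaging operators: $$\mu_{xy}v_{ijk}=\frac{h^x_ih^y_jv_{i-1,j-1,k}+h^x_{i+1}h^y_jv_{i+1,j-1,k}+12\hbar^x_i\hbar^y_jv_{ijk}+h^x_ih^y_{j+1}v_{i-1,j+1,k}+h^x_{i+1}h^y_{j+1}v_{i+1,j+1,k}}{16\,\hbar^x_i\hbar^y_j},$$ $$\mu_{xz}v_{ijk}=\frac{h^x_ih^z_kv_{i-1,j,k-1}+h^x_{i+1}h^z_kv_{i+1,j,k-1}+12\hbar^x_i\hbar^z_kv_{ijk}+h^x_ih^z_{k+1}v_{i-1,j,k+1}+h^x_{i+1}h^z_{k+1}v_{i+1,j,k+1}}{16\,\hbar^x_i\hbar^z_k},$$ $$\mu_{yz}v_{ijk}=\frac{h^y_jh^z_kv_{i,j-1,k-1}+h^y_{j+1}h^z_kv_{i,j+1,k-1}+12\hbar^y_j\hbar^z_kv_{ijk}+h^y_jh^z_{k+1}v_{i,j-1,k+1}+h^y_{j+1}h^z_{k+1}v_{i,j+1,k+1}}{16\,\hbar^y_j\hbar^z_k}.$$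 Divided differences: $\Delta^-_xv_{ijk}=(v_{ijk}-v_{i-1,j,k})/h^x_i$, $\Delta^+_xv_{ijk}=(v_{i+1,j,k}-v_{ijk})/\hbar^x_i$, and analogously $\Delta^\pm_y$ (index $j$, steps $h^y_j$, $\hbar^y_j$) and $\Delta^\pm_z$ (index $k$, steps $h^z_k$, $\hbar^z_k$). Norms: $(v,w)=\sum_{i=1}^{M_x-1}\sum_{j=1}^{M_y-1}\sum_{k=1}^{M_z-1}\hbar^x_i\hbar^y_j\hbar^z_kv_{ijk}w_{ijk}$, $\|v\|^2=(v,v)$; $$|v|_{1,h}^2=\sum_{i=1}^{M_x}\sum_{j=1}^{M_y-1}\sum_{k=1}^{M_z-1}h^x_i\hbar^y_j\hbar^z_k|\Delta^-_xv_{ijk}|^2+\sum_{i=1}^{M_x-1}\sum_{j=1}^{M_y}\sum_{k=1}^{M_z-1}\hbar^x_ih^y_j\hbar^z_k|\Delta^-_yv_{ijk}|^2+\sum_{i=1}^{M_x-1}\sum_{j=1}^{M_y-1}\sum_{k=1}^{M_z}\hbar^x_i\hbar^y_jh^z_k|\Delta^-_zv_{ijk}|^2;$$ $\|v\|_{1,h}^2=\|v\|^2+|v|_{1,h}^2$; and $\|g\|_{-1,h}=\sup_w|(g,w)|/\|w\|_{1,h}$, the supremum being over all non-zero mesh functions $w$ on $\bar\Omega^h$ vanishing on $\partial\Omega^h$. *)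

(* Defs.v *)
From mathcomp Require Import all_boot all_order all_algebra.
From mathcomp Require Import all_classical all_reals all_analysis.

Set Implicit Arguments.
Unset Strict Implicit.
Unset Printing Implicit Defensive.

Import Order.TTheory GRing.Theory Num.Theory.
Import numFieldNormedType.Exports.

Local Open Scope classical_set_scope.
Local Open Scope ring_scope.

Notation lebesgue3 R :=
  (@lebesgue_measure R \x @lebesgue_measure R \x @lebesgue_measure R)%E.

Section Sobolev.
Variable R : realType.
Local Notation R3 := (R * R * R)%type.
Local Notation mu := (lebesgue3 R).

Definition Omega : set R3 := `]0, 1[ `*` `]0, 1[ `*` `]0, 1[.

Definition enorm (p : R3) : R :=
  Num.sqrt (p.1.1 ^+ 2 + p.1.2 ^+ 2 + p.2 ^+ 2).

Definition basis3 (a : 'I_3) : R3 :=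
  ((a == inord 0)%:R, (a == inord 1)%:R, (a == inord 2)%:R).

Definition pderiv (l : seq 'I_3) (g : R3 -> R) : R3 -> R :=
  foldr (fun a h p => 'D_(basis3 a) h p) g l.

(* The derivative of multi-index (i, j, k). *)
Definition mderiv (i j k : nat) : (R3 -> R) -> R3 -> R :=
  pderiv (nseq i (inord 0) ++ nseq j (inord 1) ++ nseq k (inord 2)).

Definition smooth (g : R3 -> R) : Prop :=
  forall l, continuous (pderiv l g) /\
    forall a p, derivable (pderiv l g) p (basis3 a).

(* C_c^oo(Omega), its elements being extended by zero to R^3. *)
Definition test_function (phi : R3 -> R) : Prop :=
  let K := closure [set p | phi p != 0] in
  [/\ smooth phi, compact K & K `<=` Omega].

Definition weak_deriv (i j k : nat) (u v : R3 -> R) : Prop :=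
  forall phi, test_function phi ->
    \int[mu]_(p in Omega) (u p * mderiv i j k phi p) =
    (-1) ^+ (i + j + k) * \int[mu]_(p in Omega) (v p * phi p).

Definition L2sqnorm (u : R3 -> R) : \bar R :=
  (\int[mu]_(p in Omega) ((u p) ^+ 2)%:E)%E.

Definition slobodeckij (theta : R) (v : R3 -> R) : \bar R :=
  (\int[mu \x mu]_(q in Omega `*` Omega)
     ((v q.1 - v q.2) ^+ 2 / enorm (q.1 - q.2) `^ (3 + 2 * theta))%:E)%E.

(* Functions on Omega are represented by functions on R^3 whose values outside
   Omega are irrelevant.  The norm of H^s(Omega), s >= 0, is given in terms of
   a family D of weak derivatives of u, D i j k having multi-index (i, j, k);
   it does not depend on the choice of D, weak derivatives being unique a.e. *)
Definition sobolev_sqnorm (s : R) (D : nat -> nat -> nat -> R3 -> R) : \bar R :=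
  let m := Num.truncn s in
  let theta := s - m%:R in
  (\sum_(i < m.+1) \sum_(j < m.+1) \sum_(k < m.+1 | (i + j + k <= m)%N)
      L2sqnorm (D i j k) +
   (if (0 < theta)%R then
      \sum_(i < m.+1) \sum_(j < m.+1) \sum_(k < m.+1 | (i + j + k == m)%N)
        slobodeckij theta (D i j k)
    else 0))%E.

Definition sobolev_norm (s : R) (D : nat -> nat -> nat -> R3 -> R) : R :=
  Num.sqrt (fine (sobolev_sqnorm s D)).

(* u belongs to H^s(Omega), s >= 0, and D is a family of weak derivatives. *)
Definition sobolev_jet (s : R) (u : R3 -> R)
    (D : nat -> nat -> nat -> R3 -> R) : Prop :=
  [/\ D 0%N 0%N 0%N = u,
      forall i j k, (i + j + k <= Num.truncn s)%N ->
        measurable_fun Omega (D i j k) /\ weak_deriv i j k u (D i j k)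
    & (sobolev_sqnorm s D < +oo)%E].

Definition sobolev_ge0 (s : R) (u : R3 -> R) : Prop :=
  exists D, sobolev_jet s u D.

(* H^s_0(Omega): the closure of C_c^oo(Omega) in H^s(Omega). *)
Definition sobolev0 (s : R) (u : R3 -> R) : Prop :=
  exists2 D, sobolev_jet s u D &
    forall e : R, 0 < e -> exists2 phi, test_function phi &
      (sobolev_sqnorm s (fun i j k p => (D i j k p - mderiv i j k phi p)%R)
         < (e ^+ 2)%:E)%E.

(* Bounded linear functionals on H^s_0(Omega). *)
Definition sobolev0_dual (s : R) (F : (R3 -> R) -> R) : Prop :=
  (forall (a : R) u v, sobolev0 s u -> sobolev0 s v ->
     F (fun p => a * u p + v p) = a * F u + F v) /\
  (exists C : R, forall u D, sobolev0 s u -> sobolev_jet s u D ->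
     `|F u| <= C * sobolev_norm s D).

(* H^sigma(Omega) is a space of functions for sigma >= 0, and the dual of
   H^(-sigma)_0(Omega) for sigma < 0. *)
Inductive generalized_function : Type :=
  | Function of (R3 -> R)
  | Functional of ((R3 -> R) -> R).

Definition sobolev (sigma : R) (f : generalized_function) : Prop :=
  match f with
  | Function u => 0 <= sigma /\ sobolev_ge0 sigma u
  | Functional F => sigma < 0 /\ sobolev0_dual (- sigma) F
  end.

(* chi * f at p, where f is extended by zero from Omega to R^3; the extension
   of a functional F is psi |-> F(psi|_Omega), and its convolution with chi is
   the pairing with t |-> chi (p - t).  That function lies in the domain of F
   when chi is the indicator function of a box and sigma > -1/2. *)
Definition convolution (chi : R3 -> R) (f : generalized_function) (p : R3) : R :=
  match f with
  | Function u => \int[mu]_t (chi (p - t) * (u \_ Omega) t)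
  | Functional F => F ((fun t => chi (p - t)) \_ Omega)
  end.

End Sobolev.

Record grid (R : realType) := Grid {
  nsub : nat;
  node : nat -> R;
  node_first : node 0%N = 0;
  node_last : node nsub = 1;
  node_lt : forall i, (i < nsub)%N -> node i < node i.+1 }.

Section Mesh.
Variable R : realType.

(* For 1 <= i <= nsub X. *)
Definition step (X : grid R) (i : nat) : R := node X i - node X i.-1.

(* For 1 <= i <= nsub X - 1. *)
Definition hbar (X : grid R) (i : nat) : R := (step X i + step X i.+1) / 2.

Variables X Y Z : grid R.

Definition interior_index (i j k : nat) : Prop :=
  [/\ (0 < i < nsub X)%N, (0 < j < nsub Y)%N & (0 < k < nsub Z)%N].

Definition mesh_function : Type :=
  {ffun 'I_(nsub X).+1 * 'I_(nsub Y).+1 * 'I_(nsub Z).+1 -> R}.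

(* The operators below act on families indexed by nat; only indices of mesh
   points, where inord is exact, are ever used. *)
Definition nodal (v : mesh_function) (i j k : nat) : R :=
  v (inord i, inord j, inord k).

Definition vanishing (v : mesh_function) : Prop :=
  forall (i : 'I_(nsub X).+1) (j : 'I_(nsub Y).+1) (k : 'I_(nsub Z).+1),
    ~ interior_index i j k -> v (i, j, k) = 0.

Implicit Types v w : nat -> nat -> nat -> R.

Definition Dmx v i j k := (v i j k - v i.-1 j k) / step X i.
Definition Dpx v i j k := (v i.+1 j k - v i j k) / hbar X i.
Definition Dmy v i j k := (v i j k - v i j.-1 k) / step Y j.
Definition Dpy v i j k := (v i j.+1 k - v i j k) / hbar Y j.
Definition Dmz v i j k := (v i j k - v i j k.-1) / step Z k.
Definition Dpz v i j k := (v i j k.+1 - v i j k) / hbar Z k.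

Definition muxy v i j k :=
  (step X i * step Y j * v i.-1 j.-1 k
   + step X i.+1 * step Y j * v i.+1 j.-1 k
   + 12 * hbar X i * hbar Y j * v i j k
   + step X i * step Y j.+1 * v i.-1 j.+1 k
   + step X i.+1 * step Y j.+1 * v i.+1 j.+1 k)
  / (16 * hbar X i * hbar Y j).

Definition muxz v i j k :=
  (step X i * step Z k * v i.-1 j k.-1
   + step X i.+1 * step Z k * v i.+1 j k.-1
   + 12 * hbar X i * hbar Z k * v i j k
   + step X i * step Z k.+1 * v i.-1 j k.+1
   + step X i.+1 * step Z k.+1 * v i.+1 j k.+1)
  / (16 * hbar X i * hbar Z k).

Definition muyz v i j k :=
  (step Y j * step Z k * v i j.-1 k.-1
   + step Y j.+1 * step Z k * v i j.+1 k.-1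
   + 12 * hbar Y j * hbar Z k * v i j k
   + step Y j * step Z k.+1 * v i j.-1 k.+1
   + step Y j.+1 * step Z k.+1 * v i j.+1 k.+1)
  / (16 * hbar Y j * hbar Z k).

Definition mesh_point (i j k : nat) : R * R * R :=
  (node X i, node Y j, node Z k).

Definition half_cell (W : grid R) (i : nat) : set R :=
  `]node W i - step W i / 2, node W i + step W i.+1 / 2[.

Definition cell (i j k : nat) : set (R * R * R) :=
  half_cell X i `*` half_cell Y j `*` half_cell Z k.

Definition cell_chi (i j k : nat) (t : R * R * R) : R :=
  \1_(cell i j k) (mesh_point i j k - t).

Definition T111 (f : generalized_function R) (i j k : nat) : R :=
  convolution (cell_chi i j k) f (mesh_point i j k)
  / (hbar X i * hbar Y j * hbar Z k).

Definition mesh_inner v w : R :=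
  \sum_(1 <= i < nsub X) \sum_(1 <= j < nsub Y) \sum_(1 <= k < nsub Z)
    hbar X i * hbar Y j * hbar Z k * v i j k * w i j k.

Definition mesh_semi_sqnorm v : R :=
  \sum_(1 <= i < (nsub X).+1) \sum_(1 <= j < nsub Y) \sum_(1 <= k < nsub Z)
    step X i * hbar Y j * hbar Z k * `|Dmx v i j k| ^+ 2
  + \sum_(1 <= i < nsub X) \sum_(1 <= j < (nsub Y).+1) \sum_(1 <= k < nsub Z)
    hbar X i * step Y j * hbar Z k * `|Dmy v i j k| ^+ 2
  + \sum_(1 <= i < nsub X) \sum_(1 <= j < nsub Y) \sum_(1 <= k < (nsub Z).+1)
    hbar X i * hbar Y j * step Z k * `|Dmz v i j k| ^+ 2.

Definition mesh_H1norm v : R :=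
  Num.sqrt (mesh_inner v v + mesh_semi_sqnorm v).

(* If the mesh has no interior point, the supremum is over the empty set and
   is then 0. *)
Definition mesh_dual_norm g : R :=
  sup [set `|mesh_inner g (nodal w)| / mesh_H1norm (nodal w) |
       w in [set w : mesh_function | vanishing w /\ w != 0]].

Definition solves (f : generalized_function R) (u : mesh_function) : Prop :=
  (forall i j k, interior_index i j k ->
     - 2 * (Dpx (Dmx (muyz (nodal u))) i j k
            + Dpy (Dmy (muxz (nodal u))) i j k
            + Dpz (Dmz (muxy (nodal u))) i j k) = T111 f i j k)
  /\ vanishing u.

End Mesh.

(* Main.v *)
(* For sigma < 0 the functional f is bounded on H^s_0, s = -sigma < 1/2, so the
   convolutions make sense and are continuous as soon as indicators of boxes lie
   in H^s_0 and depend continuously on the box.  Both follow from one estimate: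
   a bounded function v that varies like a profile jumping across finitely many
   planes x_a = c satisfies |v(p) - v(q)| <= C |p - q|^k sum |p_a - c|^-k for
   every k < 1, hence its Slobodeckij integrand is at most
   C delta^eta sum |p_a - c|^-k prod |p_i - q_i|^-k where |p - q| < delta and at
   most C delta^-(3+2s) (|v(p)| + |v(q)|) elsewhere.  The H^s norm of v is thus
   small when its L^1 norm is, uniformly in the positions of the planes.  The
   smooth approximations are products of exp(-1/u), which has the same profile.

   For the scheme, summation by parts and AM-GM on the corner terms of the
   averages give (L u, u) >= |u|_{1,h}^2, and the discrete Poincare inequality
   ||u||^2 <= |u|_{1,h}^2 / 18 (from u_i^2 <= x_i (1 - x_i) sum h |Du|^2 and the
   trapezoidal rule for x (1 - x)) yields ||u||_{1,h}^2 <= (16 / 15) (L u, u). *)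

From HB Require Import structures.
Require Import Defs.
From mathcomp Require Import all_boot all_order all_algebra.
From mathcomp Require Import all_classical all_reals all_analysis.
From mathcomp Require Import measurable_realfun.
From mathcomp Require Import ring lra.

Import Order.TTheory GRing.Theory Num.Theory.
Import numFieldNormedType.Exports.

Local Open Scope classical_set_scope.
Local Open Scope ring_scope.

Set Implicit Arguments.
Unset Strict Implicit.
Unset Printing Implicit Defensive.

(** * Singular kernels and multiple integrals *)

(** The threshold -1/2 is a count of exponents. The Slobodeckij quotient has order 3 + 2s, and four
    one-dimensional kernels share it: three in the coordinates of p - q, one at the jump planes.
    Each is integrable only for an exponent below 1, so the condition is 3 + 2s < 4. The kernels are
    extended-real series, infinite at their centres: the estimates then hold at every point, also on
    the planes, and no exceptional set has to be carried along while the planes move.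

    For sigma >= 0 the datum is an L^2 function. Moving a box changes its indicator little in L^1,
    and AM-GM with a free weight transfers this to the integral against f.

    Existence of the discrete solution needs no construction: the energy inequality makes a square
    linear system injective. The final constant has some slack, since 1 + 1/18 = 19/18 lies below
    16/15 = 32/30. *)

Section SingularKernel.
Variables (R : realType) (k : R).

(** On the shell 2^-(n+1) < |t| <= 2^-n this single term already dominates |t|^-k: its coefficient
    is the value of |t|^-k at the inner radius. *)
Definition dyadic_term (n : nat) (t : R) : \bar R :=
  ((2 `^ k) ^+ n.+1 * (`|t| <= 2^-1 ^+ n)%R%:R)%:E.

(* A measurable majorant of [t |-> |t|^-k], infinite at [t = 0], where the
   library's power is [0]. *)
Definition singular (t : R) : \bar R :=
  (1 + \sum_(0 <= n <oo) dyadic_term n t)%E.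

Lemma dyadic_term_ge0 n t : (0 <= dyadic_term n t)%E.
Proof. by rewrite lee_fin mulr_ge0// exprn_ge0// powR_ge0. Qed.

Lemma singularN t : singular (- t) = singular t.
Proof. by rewrite /singular /dyadic_term normrN. Qed.

Lemma singular_ge1 t : (1 <= singular t)%E.
Proof.
by rewrite /singular leeDl// nneseries_ge0// => n _ _; exact: dyadic_term_ge0.
Qed.

Lemma singular_ge0 t : (0 <= singular t)%E.
Proof. exact: le_trans (singular_ge1 t). Qed.

Lemma singular0 : 0 < k -> singular 0 = +oo%E.
Proof.
move=> k0; apply/eqyP => A A0; rewrite /singular.
apply: (@le_trans _ _ (\sum_(0 <= n < (Num.truncn A).+1) dyadic_term n 0)%E).
  apply: (@le_trans _ _ (\sum_(0 <= n < (Num.truncn A).+1) 1)%E).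
    rewrite sumEFin lee_fin big_const_nat subn0 iter_addr_0.
    by rewrite ltW// truncnS_gt.
  apply: lee_sum => n _; rewrite /dyadic_term normr0 exprn_ge0// mulr1 lee_fin.
  by rewrite exprn_ege1// -[leLHS](powRr0 2) ler_powR ?ler1n// ltW.
apply: le_trans (nneseries_lim_ge _ _) _ => [n _ _|]; first exact: dyadic_term_ge0.
by rewrite leeDr.
Qed.

Lemma singular_ge t : 0 < k -> t != 0 -> ((`|t| `^ - k)%:E <= singular t)%E.
Proof.
move=> k0 t0; have nt0 : 0 < `|t| by rewrite normr_gt0.
have [t1|t1] := leP 1 `|t|.
  apply: le_trans (singular_ge1 t); rewrite lee_fin.
  by rewrite -[leRHS](powRr0 `|t|) ler_powR// oppr_le0 ltW.
(* The least such [n] singles out the shell of [t]: minimality, or |t| < 1 when [n] is 0, gives |t|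
   <= 2^-n, so term [n] is switched on. *)
have ex : exists n, 2^-1 ^+ n.+1 < `|t|.
  have : (@GRing.exp R 2^-1) @ \oo --> 0.
    rewrite exprn_geometric; apply: cvg_geometric.
    by rewrite gtr0_norm ?invr_gt0// invf_lt1// ltr1n.
  move/cvgrPdist_lt => /(_ _ nt0)[N _ /(_ N.+1 (leqnSn N))].
  rewrite sub0r normrN ger0_norm ?exprn_ge0 ?invr_ge0// => h.
  by exists N.
have [n hn nmin] := ex_minnP ex.
have tn : `|t| <= 2^-1 ^+ n.
  case: n nmin {hn} => [_|n nmin]; first by rewrite expr0 ltW.
  by rewrite leNgt; apply/negP => /nmin; rewrite ltnn.
apply: (@le_trans _ _ (\sum_(0 <= i < n.+1) dyadic_term i t)%E); last first.
  apply: le_trans (nneseries_lim_ge _ _) _ => [i _ _|]; first exact: dyadic_term_ge0.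
  by rewrite leeDr.
rewrite big_nat_recr//= -[leLHS]add0e leeD//.
  by apply: sume_ge0 => i _; exact: dyadic_term_ge0.
rewrite /dyadic_term tn mulr1 lee_fin -powR_mulrn ?powR_ge0// powRAC.
rewrite powRN -lef_pV2 ?posrE ?invr_gt0 ?powR_gt0// invrK.
rewrite -powR_inv1 ?powR_ge0// -powRrM mulrC powRrM powR_inv1 ?powR_ge0//.
rewrite ge0_ler_powR ?nnegrE ?invr_ge0 ?powR_ge0 ?ltW//.
by rewrite powR_mulrn// -exprVn.
Qed.

Lemma measurable_dyadic_term n :
  measurable_fun setT (dyadic_term n).
Proof.
apply/measurable_EFinP; apply: measurable_funM => //.
apply: (@eq_measurable_fun _ _ _ _ setT
  (\1_`[- 2^-1 ^+ n, 2^-1 ^+ n] : R -> R)).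
  move=> t _; rewrite indicE; congr (nat_of_bool _)%:R.
  by rewrite ler_norml; apply/idP/idP; rewrite inE/= in_itv.
exact: measurable_indic.
Qed.

Definition dyadic_sum (t : R) : \bar R := (\sum_(0 <= n <oo) dyadic_term n t)%E.

Lemma measurable_dyadic_sum : measurable_fun setT dyadic_sum.
Proof.
apply: (@ge0_emeasurable_sum _ _ _ _ dyadic_term predT).
  by move=> n t _ _; exact: dyadic_term_ge0.
by move=> n _; exact: measurable_dyadic_term.
Qed.

Lemma measurable_singular : measurable_fun setT singular.
Proof. exact: emeasurable_funD measurable_dyadic_sum. Qed.

(** Term [n] has integral at most 2^(k(n+1)) * 2 * 2^-n. This is a geometric sequence of ratio
    2^(k-1), which is below 1 because k < 1. The bound does not see the centre [c]. *)
Lemma integral_singular_le (c : R) : 0 < k < 1 ->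
  (\int[lebesgue_measure]_(x in `]0%R, 1%R[) singular (x - c)
    <= (1 + 2 `^ k * 2 / (1 - 2 `^ (k - 1)))%:E)%E.
Proof.
move=> /andP[k0 k1].
have mI : measurable (`]0, 1[%classic : set R) by [].
have msub : measurable_fun setT (fun x : R => x - c) by exact: measurable_funB.
rewrite /singular ge0_integralD//; last 2 first.
- by move=> x _; apply: nneseries_ge0 => n _ _; exact: dyadic_term_ge0.
- apply: measurable_funTS.
  exact: measurableT_comp measurable_dyadic_sum msub.
rewrite integral_cst// mul1e/= lebesgue_measure_itv/= lte_fin ltr01 oppr0 adde0.
rewrite EFinD leeD2l//.
rewrite integral_nneseries//; last 2 first.
- move=> n; apply: measurable_funTS; apply: measurableT_comp msub.
  exact: measurable_dyadic_term.
- by move=> n x _; exact: dyadic_term_ge0.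
have q0 : 0 < (2 : R) `^ (k - 1) by rewrite powR_gt0.
have q1 : `|(2 : R) `^ (k - 1)| < 1.
  rewrite gtr0_norm// /powR gt_eqF// -[ltRHS]expR0 ltr_expR.
  by rewrite pmulr_llt0 ?subr_lt0// ln_gt0// ltr1n.
have le_term n : (\int[lebesgue_measure]_(x in `]0%R, 1%R[) dyadic_term n (x - c) <=
   (2 `^ k * 2 * (2 `^ (k - 1)) ^+ n)%:E)%E.
  (* On the whole line the support is an interval of length 2 * 2^-n, wherever [c] lies. *)
  apply: (@le_trans _ _ (\int[lebesgue_measure]_x dyadic_term n (x - c))%E).
    apply: ge0_subset_integral => //.
    - by apply: measurableT_comp msub; exact: measurable_dyadic_term.
    - by move=> x _; exact: dyadic_term_ge0.
  under eq_integral => x _.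
    rewrite /dyadic_term EFinM.
    have -> : (`|x - c| <= 2^-1 ^+ n)%R%:R%:E =
        (\1_`[c - 2^-1 ^+ n, c + 2^-1 ^+ n] x)%:E :> \bar R.
      rewrite indicE; congr (nat_of_bool _)%:R%:E.
      rewrite ler_distl; apply/idP/idP; rewrite inE/= in_itv/=; last by [].
      by [].
    over.
  rewrite ge0_integralZl_EFin//; last first.
    by apply/measurable_EFinP; exact: measurable_indic.
  rewrite integral_indic// setIT/= lebesgue_measure_itv/= lte_fin.
  have h0 : 0 < (2^-1 : R) ^+ n by rewrite exprn_gt0.
  rewrite ifT; last by lra.
  rewrite -EFinB -EFinM lee_fin powRB ?implybT//; last first.
  by apply/implyP.
  rewrite powRr1// exprMn exprSr exprVn.
  rewrite le_eqVlt; apply/orP; left; apply/eqP.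
  by field; rewrite expf_neq0.
apply: lime_le.
  by apply: is_cvg_nneseries => n _ _; apply: integral_ge0 => x _;
     exact: dyadic_term_ge0.
apply: nearW => n.
apply: (@le_trans _ _ (\sum_(0 <= i < n)
    (2 `^ k * 2 * (2 `^ (k - 1)) ^+ i)%:E)%E); first exact: lee_sum.
rewrite sumEFin lee_fin.
by apply: geometric_le_lim; rewrite ?mulr_ge0 ?powR_ge0.
Qed.

End SingularKernel.

(** * Tonelli's theorem on the unit cube *)

Section ProductIntegrals.
Local Open Scope ereal_scope.

Lemma ge0_integral_setX d1 d2 (T1 : measurableType d1) (T2 : measurableType d2)
    (R : realType) (m1 : {sigma_finite_measure set T1 -> \bar R})
    (m2 : {sigma_finite_measure set T2 -> \bar R}) (A : set T1) (B : set T2)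
    (f : T1 * T2 -> \bar R) :
  measurable A -> measurable B -> measurable_fun setT f ->
  (forall z, 0 <= f z) ->
  \int[m1 \x m2]_(z in A `*` B) f z = \int[m1]_(x in A) \int[m2]_(y in B) f (x, y).
Proof.
move=> mA mB mf f0.
have mAB : measurable (A `*` B) by exact: measurableX.
rewrite integral_mkcond fubini_tonelli1; last 2 first.
- by apply/(measurable_restrictT _ mAB); exact: measurable_funTS.
- by move=> z; apply: erestrict_ge0.
rewrite [RHS]integral_mkcond; apply: eq_integral => x _.
rewrite /fubini_F patchE; case: ifPn => xA.
  rewrite [RHS]integral_mkcond; apply: eq_integral => y _.
  by rewrite !patchE in_setX xA.
rewrite integral0_eq// => y _.
by rewrite patchE in_setX (negbTE xA).
Qed.

Section SigmaFiniteProduct.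
Context d1 d2 (T1 : measurableType d1) (T2 : measurableType d2) (R : realType).
Variable m1 : {sigma_finite_measure set T1 -> \bar R}.
Variable m2 : {sigma_finite_measure set T2 -> \bar R}.

Lemma product_sigma_finite : sigma_finite setT (m1 \x m2).
Proof.
have /sigma_finiteP[F [TF ndF Foo]] := sigma_finiteT m1.
have /sigma_finiteP[G [TG ndG Goo]] := sigma_finiteT m2.
exists (fun n => F n `*` G n) => [|n].
  rewrite -setXTT TF TG; apply/seteqP; split=> [[x y] [/= [i _ Fx] [j _ Gy]]|].
    exists (maxn i j) => //; split=> /=.
    + by move: x Fx; exact/subsetPset/ndF/leq_maxl.
    + by move: y Gy; exact/subsetPset/ndG/leq_maxr.
  by move=> [x y] [n _ [/= Fx Gy]]; split; exists n.
have [mF Fn] := Foo n; have [mG Gn] := Goo n; split; first exact: measurableX.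
by rewrite product_measure1E// lte_mul_pinfty// ge0_fin_numE.
Qed.

(* The library's canonical [sigma_finite_measure] structure on [m1 \x m2] is
   only found for subprobabilities. *)
Definition sigma_finite_product :
    {sigma_finite_measure set (T1 * T2)%type -> \bar R} :=
  HB.pack (m1 \x m2)
    (Measure_isSigmaFinite.Build _ _ _ (m1 \x m2) product_sigma_finite).

End SigmaFiniteProduct.

Lemma ge0_integral_prod3 d1 d2 d3 (T1 : measurableType d1)
    (T2 : measurableType d2) (T3 : measurableType d3) (R : realType)
    (m1 : {sigma_finite_measure set T1 -> \bar R})
    (m2 : {sigma_finite_measure set T2 -> \bar R})
    (m3 : {sigma_finite_measure set T3 -> \bar R})
    (A : set T1) (B : set T2) (C : set T3)
    (f : T1 -> \bar R) (g : T2 -> \bar R) (h : T3 -> \bar R) :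
  measurable A -> measurable B -> measurable C ->
  measurable_fun setT f -> measurable_fun setT g -> measurable_fun setT h ->
  (forall x, 0 <= f x) -> (forall x, 0 <= g x) -> (forall x, 0 <= h x) ->
  \int[m1 \x m2 \x m3]_(p in A `*` B `*` C) (f p.1.1 * g p.1.2 * h p.2) =
  (\int[m1]_(x in A) f x) * (\int[m2]_(x in B) g x) * (\int[m3]_(x in C) h x).
Proof.
move=> mA mB mC mf mg mh f0 g0 h0.
have mfg : measurable_fun setT (fun z : T1 * T2 => f z.1 * g z.2).
  by apply: emeasurable_funM; exact: measurableT_comp.
have mAB : measurable (A `*` B) by exact: measurableX.
have mABC : measurable_fun setT (fun p : T1 * T2 * T3 => f p.1.1 * g p.1.2 * h p.2).
  by apply: emeasurable_funM; [exact: measurableT_comp mfg _|exact: measurableT_comp].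
transitivity (\int[m1 \x m2]_(z in A `*` B) \int[m3]_(t in C)
    (f z.1 * g z.2 * h t)).
  apply: (ge0_integral_setX (sigma_finite_product m1 m2) m3 mAB mC mABC).
  by move=> z; rewrite !mule_ge0.
under eq_integral => z _.
  rewrite /= ge0_integralZl//; last 2 first.
  - exact: measurable_funTS.
  - by rewrite mule_ge0.
  over.
rewrite ge0_integralZr//; last 3 first.
- exact: measurable_funTS.
- by move=> z _; rewrite mule_ge0.
- exact: integral_ge0.
congr (_ * _).
rewrite ge0_integral_setX//; last by move=> z; rewrite mule_ge0.
under eq_integral => z _.
  by rewrite /= ge0_integralZl//; last exact: measurable_funTS; over.
rewrite ge0_integralZr//; last exact: integral_ge0.
exact: measurable_funTS.
Qed.

Variable R : realType.
Local Notation R3 := (R * R * R)%type.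
Local Notation leb := (@lebesgue_measure R).
Local Notation I := (`]0%R, 1%R[%classic : set R).

Lemma measurable_Omega : measurable (@Omega R).
Proof. by apply: measurableX; first exact: measurableX. Qed.

Lemma ge0_integral_Omega_prod (f g h : R -> \bar R) :
  measurable_fun setT f -> measurable_fun setT g -> measurable_fun setT h ->
  (forall x, 0 <= f x) -> (forall x, 0 <= g x) -> (forall x, 0 <= h x) ->
  \int[lebesgue3 R]_(p in @Omega R) (f p.1.1 * g p.1.2 * h p.2) =
  (\int[leb]_(x in I) f x) * (\int[leb]_(x in I) g x) * (\int[leb]_(x in I) h x).
Proof. by move=> *; exact: ge0_integral_prod3. Qed.

Lemma lebesgue_unit_itv : \int[leb]_(x in I) 1 = 1.
Proof.
by rewrite integral_cst// mul1e/= lebesgue_measure_itv/= lte_fin ltr01 oppr0 adde0.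
Qed.

Lemma lebesgue3_Omega : lebesgue3 R (@Omega R) = 1.
Proof.
have := @ge0_integral_Omega_prod (cst 1) (cst 1) (cst 1).
rewrite /= lebesgue_unit_itv !mule1 integral_cst; last exact: measurable_Omega.
by rewrite mul1e; apply.
Qed.

(** Coordinates are indexed so that the six faces of a box can later be treated by one product over
    ['I_3 * bool]. *)
Definition coord (a : 'I_3) : R3 -> R :=
  if a == inord 0 then fun p => p.1.1
  else if a == inord 1 then fun p => p.1.2 else snd.

Lemma measurable_coord a : measurable_fun setT (coord a).
Proof.
rewrite /coord; case: ifP => _.
  exact: measurableT_comp measurable_fst measurable_fst.
case: ifP => _; last exact: measurable_snd.
exact: measurableT_comp measurable_snd measurable_fst.
Qed.

Lemma ge0_integral_coord (a : 'I_3) (f : R -> \bar R) :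
  measurable_fun setT f -> (forall x, 0 <= f x) ->
  \int[lebesgue3 R]_(p in @Omega R) f (coord a p) = \int[leb]_(x in I) f x.
Proof.
move=> mf f0; rewrite /coord; case: ifP => _; [|case: ifP => _].
- have := @ge0_integral_Omega_prod f (cst 1) (cst 1) mf.
  rewrite /= lebesgue_unit_itv !mule1 => <-//.
  by apply: eq_integral => p _; rewrite !mule1.
- have := @ge0_integral_Omega_prod (cst 1) f (cst 1) _ mf.
  rewrite /= lebesgue_unit_itv !mule1 mul1e => <-//.
  by apply: eq_integral => p _; rewrite mule1 mul1e.
- have := @ge0_integral_Omega_prod (cst 1) (cst 1) f _ _ mf.
  rewrite /= lebesgue_unit_itv !mul1e => <-//.
  by apply: eq_integral => p _; rewrite !mul1e.
Qed.

Variable k : R.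
Hypothesis k01 : (0 < k < 1)%R.

Definition singular_mass : R := 1 + 2 `^ k * 2 / (1 - 2 `^ (k - 1)).

Lemma integral_singular_coord a c :
  \int[lebesgue3 R]_(p in @Omega R) singular k (coord a p - c)%R <= singular_mass%:E.
Proof.
rewrite (@ge0_integral_coord a (fun x : R => singular k (x - c)%R)).
- exact: integral_singular_le.
- by apply: measurableT_comp; [exact: measurable_singular|exact: measurable_funB].
- by move=> x; exact: singular_ge0.
Qed.

(** Stands in for the Euclidean kernel |h|^-(3k): a product of one-variable kernels is integrated
    one coordinate at a time. *)
Definition singular3 (h : R3) : \bar R :=
  singular k h.1.1 * singular k h.1.2 * singular k h.2.

Lemma singular3_ge0 h : 0 <= singular3 h.
Proof. by rewrite !mule_ge0// singular_ge0. Qed.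

Lemma integral_singular3 (p : R3) :
  \int[lebesgue3 R]_(q in @Omega R) singular3 (p - q)%R <= (singular_mass ^+ 3)%:E.
Proof.
have msing (c : R) : measurable_fun setT (fun x : R => singular k (c - x)%R).
  by apply: measurableT_comp; [exact: measurable_singular|exact: measurable_funB].
have int1 (c : R) : \int[leb]_(x in I) singular k (c - x)%R <= singular_mass%:E.
  under eq_integral => x _ do rewrite -opprB singularN.
  exact: integral_singular_le.
rewrite (@ge0_integral_Omega_prod (fun x : R => singular k (p.1.1 - x)%R)
  (fun x : R => singular k (p.1.2 - x)%R) (fun x => singular k (p.2 - x)%R))//;
  try by move=> x; exact: singular_ge0.
have int0 (c : R) : 0 <= \int[leb]_(x in I) singular k (c - x)%R.
  by apply: integral_ge0 => x _; exact: singular_ge0.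
by rewrite !exprS expr0 mulr1 mulrA !EFinM !lee_pmul// mule_ge0.
Qed.

End ProductIntegrals.

Ltac side_condition :=
  solve [ by []
        | try (move=> ? _);
          repeat first [ by [] | apply: adde_ge0 | apply: mule_ge0
                       | rewrite lee_fin; by [] ]
        | apply: measurable_funTS;
          repeat first [ by [] | apply: emeasurable_funD
                       | apply: emeasurable_funM ] ].

Section DoubleIntegralBound.
Local Open Scope ereal_scope.
Context d (T : measurableType d) (R : realType).
Variable m : {sigma_finite_measure set T -> \bar R}.

(** The variable [y] is integrated first: [K] then contributes at most [C] whatever [x] is, and
    [g x] stays unchanged because [D] has mass 1. This works because the singular factor [S] depends
    on [x] alone. *)
Lemma double_integral_le (D : set T) (f K : T * T -> \bar R) (g S : T -> \bar R)
    (a b C : R) :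
  measurable D -> m D = 1 -> (0 <= a)%R -> (0 <= b)%R ->
  measurable_fun setT f -> measurable_fun setT K ->
  measurable_fun setT g -> measurable_fun setT S ->
  (forall z, 0 <= f z) -> (forall z, 0 <= K z) ->
  (forall x, 0 <= g x) -> (forall x, 0 <= S x) ->
  (forall x y, f (x, y) <= a%:E * (g x + g y) + b%:E * (S x * K (x, y))) ->
  (forall x, \int[m]_(y in D) K (x, y) <= C%:E) ->
  \int[m \x m]_(z in D `*` D) f z <=
    a%:E * (\int[m]_(x in D) g x + \int[m]_(x in D) g x) +
    b%:E * (C%:E * \int[m]_(x in D) S x).
Proof.
move=> mD D1 a0 b0 mf mK mg mS f0 K0 g0 S0 fle Kle.
have intD c : \int[m]_(y in D) cst c y = c.
  by rewrite integral_cst// -[RHS]mule1; congr (_ * _).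
have C0 : (0 <= C)%R.
  have [t _] : D !=set0.
    apply/set0P/eqP => D0; move: D1; rewrite D0 measure0 => /eqP.
    by rewrite eqe eq_sym oner_eq0.
  by rewrite -lee_fin (le_trans _ (Kle t))// integral_ge0.
have mg1 : measurable_fun setT (fun z : T * T => g z.1) by exact: measurableT_comp.
have mg2 : measurable_fun setT (fun z : T * T => g z.2) by exact: measurableT_comp.
have mS1 : measurable_fun setT (fun z : T * T => S z.1) by exact: measurableT_comp.
pose F (z : T * T) := a%:E * (g z.1 + g z.2) + b%:E * (S z.1 * K z).
have mF : measurable_fun setT F.
  apply: emeasurable_funD; apply: emeasurable_funM => //.
    exact: emeasurable_funD.
  exact: emeasurable_funM.
have F0 z : 0 <= F z by rewrite adde_ge0// mule_ge0 ?lee_fin ?adde_ge0 ?mule_ge0.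
apply: (@le_trans _ _ (\int[m \x m]_(z in D `*` D) F z)).
  apply: ge0_le_integral => //; first exact: measurableX.
  - exact: measurable_funTS.
  - exact: measurable_funTS.
  - by move=> [x y] _; exact: fle.
rewrite ge0_integral_setX//.
have mKx x : measurable_fun setT (fun y => K (x, y)) by exact: measurableT_comp.
have inner x : \int[m]_(y in D) F (x, y) =
    a%:E * (g x + \int[m]_(y in D) g y) + b%:E * (S x * \int[m]_(y in D) K (x, y)).
  rewrite /F/= ge0_integralD//; last 4 first.
  - by move=> y _; rewrite mule_ge0 ?lee_fin// adde_ge0.
  - by apply: measurable_funTS; apply: emeasurable_funM => //; exact: emeasurable_funD.
  - by move=> y _; rewrite !mule_ge0 ?lee_fin.
  - by apply: measurable_funTS; apply: emeasurable_funM => //; exact: emeasurable_funM.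
  congr (_ + _).
    rewrite ge0_integralZl; try side_condition.
    rewrite ge0_integralD; try side_condition.
    by rewrite intD.
  rewrite ge0_integralZl; try side_condition.
  by rewrite ge0_integralZl; try side_condition.
under eq_integral => x _ do rewrite inner.
have A0 : 0 <= \int[m]_(y in D) g y by exact: integral_ge0.
apply: (@le_trans _ _ (\int[m]_(x in D) (a%:E * (g x + \int[m]_(y in D) g y)
    + b%:E * (C%:E * S x)))).
  (* The inner integral is measurable by Tonelli's theorem, applied to [K] cut off outside [D] in
     its second variable. *)
  have mint : measurable_fun setT (fun x => \int[m]_(y in D) K (x, y)).
    have mTD : measurable ([set: T] `*` D) by exact: measurableX.
    have := @measurable_fun_fubini_tonelli_F _ _ _ _ _ m
      (K \_ (setT `*` D)).
    rewrite (_ : fubini_F _ _ = fun x => \int[m]_(y in D) K (x, y)).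
      apply.
        by apply/(measurable_restrictT _ mTD); exact: measurable_funTS.
      by move=> z; exact: erestrict_ge0.
    apply/funext => x; rewrite /fubini_F [RHS]integral_mkcond.
    by apply: eq_integral => y _; rewrite !patchE in_setX in_setT.
  have IK0 x : 0 <= \int[m]_(y in D) K (x, y) by exact: integral_ge0.
  apply: ge0_le_integral; try side_condition.
  move=> x _; rewrite leeD2l// lee_wpmul2l ?lee_fin//.
  by rewrite [leRHS]muleC lee_wpmul2l.
rewrite ge0_integralD; try side_condition.
rewrite leeD//.
  rewrite ge0_integralZl; try side_condition.
  rewrite ge0_integralD; try side_condition.
  by rewrite intD.
rewrite ge0_integralZl; try side_condition.
by rewrite ge0_integralZl; try side_condition.
Qed.

End DoubleIntegralBound.

(** * Bounded functions with jumps across planes *)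

Section Profiles.
Variable R : realType.
Local Notation R3 := (R * R * R)%type.
Implicit Types (v w : R3 -> R) (p q h : R3).

Lemma enorm_ge0 p : 0 <= enorm p. Proof. exact: sqrtr_ge0. Qed.

Lemma inord3_eq (i j : nat) : (i < 3)%N -> (j < 3)%N ->
  (inord i == inord j :> 'I_3) = (i == j).
Proof. by move=> ? ?; rewrite -val_eqE/= !inordK. Qed.

Lemma coordE p : (coord (inord 0) p = p.1.1) * (coord (inord 1) p = p.1.2) *
  (coord (inord 2) p = p.2).
Proof. by rewrite /coord !inord3_eq. Qed.

Lemma coordB a p q : coord a (p - q) = coord a p - coord a q.
Proof. by rewrite /coord; case: ifP => // _; case: ifP. Qed.

Lemma coord_le_enorm a h : `|coord a h| <= enorm h.
Proof.
rewrite -sqrtr_sqr ler_sqrt ?addr_ge0 ?sqr_ge0//.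
have [x0 y0 z0] := And3 (sqr_ge0 h.1.1) (sqr_ge0 h.1.2) (sqr_ge0 h.2).
by rewrite /coord; case: ifP => _; [|case: ifP => _]; lra.
Qed.

Lemma enorm_gt0 h : h != 0 -> 0 < enorm h.
Proof.
move=> h0; rewrite lt_neqAle enorm_ge0 andbT eq_sym; apply: contra h0 => /eqP e0.
have c0 a : coord a h = 0.
  by apply/eqP; rewrite -normr_le0 -e0 coord_le_enorm.
have := c0 (inord 0); have := c0 (inord 1); have := c0 (inord 2).
rewrite !coordE.
by case: h {e0 c0} => [[x y] z] /= -> -> ->.
Qed.

(** The last condition is invariant under dilation about [c]. A jump at [c] and its mollifications
    of every width therefore share the constant 2, which makes later bounds uniform in the width. *)
Definition step_like (c : R) (f : R -> R) : Prop :=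
  [/\ measurable_fun setT f, forall x, 0 <= f x <= 1 &
      forall x y, `|f x - f y| * `|x - c| <= 2 * `|x - y|].

Variable k : R.
Hypothesis k01 : 0 < k < 1.

(** Interpolation: with x = d / |t| the hypotheses say that D is at most 1 and at most 2x, and both
    cases give D <= 2 x^k for 0 < k < 1. For t = 0 the right-hand side is infinite. *)
Lemma le_singular (D d t : R) : 0 <= D <= 1 -> 0 < d -> D * `|t| <= 2 * d ->
  (D%:E <= (2 * d `^ k)%:E * singular k t)%E.
Proof.
have /andP[k0 k1] := k01; move=> /andP[D0 D1] d0 Dt.
have [->|t0] := eqVneq t 0.
  by rewrite singular0// gt0_muley ?leey// lte_fin mulr_gt0 ?powR_gt0.
have e0 : 0 < `|t| by rewrite normr_gt0.
apply: le_trans (_ : (2 * d `^ k)%:E * (`|t| `^ - k)%:E <= _)%E; last first.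
  by rewrite lee_pmul2l ?lte_fin ?mulr_gt0 ?powR_gt0//; exact: singular_ge.
rewrite -EFinM lee_fin powRN.
set x := d / `|t|; have x0 : 0 < x by rewrite divr_gt0.
have -> : 2 * d `^ k / `|t| `^ k = 2 * x `^ k.
  rewrite powRM ?invr_ge0 ?(ltW d0)// -[in RHS](powR_inv1 (ltW e0)) powRAC.
  by rewrite powR_inv1 ?powR_ge0// mulrA.
have D2x : D <= 2 * x by rewrite mulrA ler_pdivlMr.
have [x1|x1] := leP 1 x.
  have : 1 <= x `^ k by rewrite -[leLHS](powRr0 x) ler_powR// ltW.
  by lra.
have : x <= x `^ k by rewrite ger1_powR ?x0 ?ltW.
by lra.
Qed.

Lemma step_like_singular c f x y : step_like c f ->
  (`|f x - f y|%:E <= (2 * `|x - y| `^ k)%:E * singular k (x - c))%E.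
Proof.
move=> [_ f01 fc]; have [->|xy] := eqVneq x y.
  by rewrite subrr normr0 mule_ge0 ?lee_fin ?mulr_ge0 ?powR_ge0 ?singular_ge0.
apply: le_singular => //; last by rewrite normr_gt0 subr_eq0.
by rewrite normr_ge0 ler_distl; have := f01 x; have := f01 y; lra.
Qed.

(* The singular centres make the difference quotients of [v] of order [k]
   integrable even when [v] jumps across planes. *)
Definition profile (n : nat) v : Prop :=
  [/\ measurable_fun setT v, forall p, `|v p| <= n%:R &
      exists2 cs : seq ('I_3 * R), size cs = n & forall p q,
        (`|v p - v q|%:E <= (2 * enorm (p - q) `^ k)%:E *
           \sum_(c <- cs) singular k (coord c.1 p - c.2))%E].

Lemma profileB m n v w : profile m v -> profile n w ->
  profile (m + n) (fun p => v p - w p).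
Proof.
move=> [mv vm [cs csm vcs]] [mw wn [ds dsn wds]]; split.
- exact: measurable_funB.
- by move=> p; rewrite natrD (le_trans (ler_normB _ _))// lerD.
- exists (cs ++ ds); first by rewrite size_cat csm dsn.
  move=> p q; rewrite big_cat/= ge0_muleDr; last 2 first.
  + by apply: sume_ge0 => c _; exact: singular_ge0.
  + by apply: sume_ge0 => c _; exact: singular_ge0.
  apply: (@le_trans _ _ (`|v p - v q|%:E + `|w p - w q|%:E)%E).
    rewrite -EFinD lee_fin.
    by rewrite (_ : _ - _ = v p - v q - (w p - w q)) ?ler_normB//; ring.
  exact: leeD.
Qed.

(** Telescoping: factors are exchanged one at a time while all the others stay in [0, 1]. *)
Lemma distr_prod_le (I : Type) (r : seq I) (F G : I -> R) :
  (forall i, 0 <= F i <= 1) -> (forall i, 0 <= G i <= 1) ->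
  `|\prod_(i <- r) F i - \prod_(i <- r) G i| <= \sum_(i <- r) `|F i - G i|.
Proof.
move=> F01 G01; elim: r => [|i r IH]; first by rewrite !big_nil subrr normr0.
rewrite !big_cons.
have -> : F i * \prod_(j <- r) F j - G i * \prod_(j <- r) G j =
  (F i - G i) * \prod_(j <- r) F j +
  G i * (\prod_(j <- r) F j - \prod_(j <- r) G j) by ring.
rewrite (le_trans (ler_normD _ _))// !normrM lerD//.
  rewrite ler_piMr// ger0_norm; last by apply: prodr_ge0 => j _; have /andP[] := F01 j.
  by apply: prodr_ile1 => j _ ; exact: F01.
rewrite ger0_norm; last by have /andP[] := G01 i.
by rewrite (le_trans _ IH)// ler_piMl//; have /andP[] := G01 i.
Qed.

Definition tensor (I : finType) (a : I -> 'I_3) (f : I -> R -> R) p : R :=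
  \prod_(i : I) f i (coord (a i) p).

Lemma measurable_tensor (I : finType) (a : I -> 'I_3) (f : I -> R -> R) :
  (forall i, measurable_fun setT (f i)) -> measurable_fun setT (tensor a f).
Proof.
move=> mf; apply: measurable_prod => i _.
by apply: measurableT_comp (mf i) _; exact: measurable_coord.
Qed.

(** The distance of the products splits over the factors, and [le_singular] bounds each difference
    by d^k times a kernel centred at [c i]. The mass of that kernel does not depend on the
    centre. *)
Lemma integral_tensor_dist_le (I : finType) (a : I -> 'I_3) (c : I -> R)
    (f g : I -> R -> R) (d : R) :
  (forall i, measurable_fun setT (f i)) -> (forall i, measurable_fun setT (g i)) ->
  (forall i x, 0 <= f i x <= 1) -> (forall i x, 0 <= g i x <= 1) -> 0 < d ->
  (forall i x, `|f i x - g i x| * `|x - c i| <= 2 * d) ->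
  (\int[lebesgue3 R]_(p in @Omega R) `|tensor a f p - tensor a g p|%:E <=
    (#|I|%:R * (2 * d `^ k * singular_mass k))%:E)%E.
Proof.
move=> mf mg f01 g01 d0 fg.
have mO := @measurable_Omega R.
have mS i : measurable_fun setT (fun p => singular k (coord (a i) p - c i)).
  apply: (measurableT_comp (measurable_singular _)).
  by apply: measurable_funB => //; exact: measurable_coord.
have mdS i : measurable_fun (@Omega R)
    (fun p => (2 * d `^ k)%:E * singular k (coord (a i) p - c i))%E.
  by apply: measurable_funTS; apply: emeasurable_funM.
apply: (@le_trans _ _ (\int[lebesgue3 R]_(p in @Omega R) \sum_(i : I)
    ((2 * d `^ k)%:E * singular k (coord (a i) p - c i)))%E).
  apply: ge0_le_integral => //.
  - apply/measurable_EFinP; apply: measurableT_comp => //.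
    by apply: measurable_funTS; apply: measurable_funB; exact: measurable_tensor.
  - by apply: emeasurable_sum => i _; exact: mdS.
  - move=> p _; apply: (@le_trans _ _
      (\sum_(i : I) `|f i (coord (a i) p) - g i (coord (a i) p)|%:E)%E).
      by rewrite sumEFin lee_fin; exact: distr_prod_le.
    apply: lee_sum => i _; apply: le_singular => //.
    rewrite normr_ge0 ler_distl.
    by have := f01 i (coord (a i) p); have := g01 i (coord (a i) p); lra.
rewrite ge0_integral_sum//; last first.
  by move=> i p _; rewrite mule_ge0 ?singular_ge0// lee_fin mulr_ge0 ?powR_ge0.
apply: (@le_trans _ _ (\sum_(i : I) (2 * d `^ k * singular_mass k)%:E)%E).
  apply: lee_sum => i _; rewrite ge0_integralZl_EFin; try solve
    [ by [] | by move=> p _; exact: singular_ge0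
    | by apply: measurable_funTS; exact: mS
    | by rewrite mulr_ge0 ?powR_ge0 ].
  rewrite [leRHS]EFinM lee_wpmul2l ?lee_fin ?mulr_ge0 ?powR_ge0//.
  exact: integral_singular_coord.
rewrite sumEFin.
by rewrite sumr_const lee_fin [leRHS]mulr_natl.
Qed.

(** Each factor brings one singular centre. The product is bounded by 1, weakened here to [#|I|]
    because one integer in [profile] serves both as sup bound and as number of centres. *)
Lemma tensor_profile (I : finType) (a : I -> 'I_3) (c : I -> R) (f : I -> R -> R) :
  (0 < #|I|)%N -> (forall i, step_like (c i) (f i)) -> profile #|I| (tensor a f).
Proof.
move=> I0 fc.
have f01 i x : 0 <= f i x <= 1 by have [] := fc i.
split.
- by apply: measurable_tensor => i; have [] := fc i.
- move=> p; apply: (@le_trans _ _ 1); last by rewrite ler1n.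
  rewrite ger0_norm; last by apply: prodr_ge0 => i _; have /andP[] := f01 i (coord (a i) p).
  by apply: prodr_ile1 => i _; exact: f01.
- exists [seq (a i, c i) | i <- enum I].
    by rewrite size_map -cardE.
  move=> p q; rewrite big_map big_enum/= ge0_sume_distrr; last by move=> i _; exact: singular_ge0.
  apply: (@le_trans _ _ (\sum_(i : I) `|f i (coord (a i) p) - f i (coord (a i) q)|%:E)%E).
    by rewrite sumEFin lee_fin; exact: distr_prod_le.
  apply: lee_sum => i _; apply: (le_trans (step_like_singular _ _ (fc i))).
  rewrite lee_wpmul2r ?singular_ge0// lee_fin ler_wpM2l//.
  rewrite ge0_ler_powR ?nnegrE ?enorm_ge0//; first by have /andP[/ltW] := k01.
  by rewrite -coordB coord_le_enorm.
Qed.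

(** Each coordinate is at most |h| in absolute value, so |h|^-k is below each of the three
    one-variable kernels. *)
Lemma powR_enorm_le_singular3 h : h != 0 ->
  ((enorm h `^ - (3 * k))%:E <= singular3 k h)%E.
Proof.
move=> h0; have /andP[k0 k1] := k01; have e0 := enorm_gt0 h0.
have le1 a : ((enorm h `^ - k)%:E <= singular k (coord a h))%E.
  have [->|ha] := eqVneq (coord a h) 0; first by rewrite singular0// leey.
  apply: (le_trans _ (singular_ge k0 ha)); rewrite lee_fin !powRN.
  rewrite lef_pV2 ?posrE ?powR_gt0 ?normr_gt0//.
  by rewrite ge0_ler_powR ?nnegrE ?enorm_ge0 ?(ltW k0)// coord_le_enorm.
have -> : enorm h `^ (- (3 * k)) =
    enorm h `^ (- k) * enorm h `^ (- k) * enorm h `^ (- k).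
  rewrite (_ : - (3 * k) = - k + - k + - k); last by ring.
  by rewrite !powRD ?(gt_eqF e0) ?implybT.
rewrite !EFinM /singular3.
have := le1 (inord 0); have := le1 (inord 1); have := le1 (inord 2).
rewrite !coordE => h2 h1 h3.
by rewrite !lee_pmul ?mule_ge0// lee_fin ?mulr_ge0 ?powR_ge0.
Qed.

End Profiles.

(** * Smallness of Sobolev norms *)

Ltac nonneg :=
  repeat first [ by [] | exact: powR_ge0 | exact: singular3_ge0
    | exact: singular_ge0 | exact: exprn_ge0 | rewrite lee_fin
    | rewrite invr_ge0 | apply: mulr_ge0 | apply: addr_ge0
    | apply: mule_ge0 | apply: adde_ge0 ].

Section SlobodeckijBound.
Variables (R : realType) (s : R).
Hypothesis s01 : 0 < s < 1 / 2.
Local Notation R3 := (R * R * R)%type.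
Implicit Types (v : R3 -> R) (p q : R3).

(* They solve [4 kernel_order = 3 + 2 s + gain]: the numerator of the Slobodeckij
   quotient contributes one factor [|p - q|^kernel_order], the kernels in the three
   coordinates absorb [|p - q|^-(3 kernel_order)], and [gain > 0] is left. *)
Definition kernel_order : R := (7 + 2 * s) / 8.
Definition gain : R := (1 - 2 * s) / 2.

Lemma kernel_order01 : 0 < kernel_order < 1.
Proof. by have /andP[s0 s1] := s01; rewrite /kernel_order; apply/andP; split; lra. Qed.

Lemma measurable_enorm : measurable_fun setT (@enorm R).
Proof.
rewrite (_ : @enorm R = fun p => (coord (inord 0) p ^+ 2 +
    coord (inord 1) p ^+ 2 + coord (inord 2) p ^+ 2) `^ 2^-1).
  apply: (measurableT_comp (measurable_powR _)).
  by apply: measurable_funD; [apply: measurable_funD|]; apply: measurable_funX;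
    exact: measurable_coord.
apply/funext => p; rewrite powR12_sqrt ?addr_ge0 ?sqr_ge0//.
by rewrite !coordE.
Qed.

Lemma measurable_fun_R3 d (T : measurableType d) (f : T -> R3) :
  (forall a, measurable_fun setT (coord a \o f)) -> measurable_fun setT f.
Proof.
move=> mf; apply/measurable_fun_pairP; split.
  apply/measurable_fun_pairP; split.
    by have := mf (inord 0); apply: eq_measurable_fun => t _ /=; rewrite coordE.
  by have := mf (inord 1); apply: eq_measurable_fun => t _ /=; rewrite coordE.
by have := mf (inord 2); apply: eq_measurable_fun => t _ /=; rewrite coordE.
Qed.

Lemma measurable_sub_R3 : measurable_fun setT (fun z : R3 * R3 => z.1 - z.2).
Proof.
apply: measurable_fun_R3 => a.
rewrite (_ : _ \o _ = fun z => coord a z.1 - coord a z.2).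
  by apply: measurable_funB; apply: measurableT_comp => //; exact: measurable_coord.
by apply/funext => z; rewrite /= coordB.
Qed.

Lemma measurable_singular3 : measurable_fun setT (@singular3 R kernel_order).
Proof.
rewrite (_ : @singular3 R kernel_order = fun h => (singular kernel_order (coord (inord 0) h) *
   singular kernel_order (coord (inord 1) h) * singular kernel_order (coord (inord 2) h))%E).
  apply: emeasurable_funM; [apply: emeasurable_funM|];
    apply: measurableT_comp (measurable_singular _) (measurable_coord _).
by apply/funext => h; rewrite !coordE.
Qed.

Lemma slobodeckij_quotient_le (n : nat) v (S : \bar R) (delta : R) p q :
  (0 <= S)%E -> (forall p, `|v p| <= n%:R) -> 0 < delta ->
  (`|v p - v q|%:E <= (2 * enorm (p - q) `^ kernel_order)%:E * S)%E ->
  (((v p - v q) ^+ 2 / enorm (p - q) `^ (3 + 2 * s))%:E <=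
   (2 * n%:R * delta `^ (- (3 + 2 * s)))%:E * (`|v p|%:E + `|v q|%:E) +
   (4 * n%:R * delta `^ gain)%:E * (S * singular3 kernel_order (p - q)%R))%E.
Proof.
move=> S0 vn d0 vS; have /andP[s0 s1] := s01; have /andP[k0 k1] := kernel_order01.
set D := `|v p - v q| in vS *; set e := enorm (p - q) in vS *.
(* One factor of the square is bounded by 2n and only the other is left for the profile estimate:
   the kernel order exceeds 1/2, so a squared kernel would not be integrable. *)
have D2 : (v p - v q) ^+ 2 <= 2 * n%:R * D.
  rewrite -real_normK ?num_real// expr2 ler_wpM2r//.
  by have := vn p; have := vn q; have := ler_normB (v p) (v q); lra.
have DA : D <= `|v p| + `|v q| by exact: ler_normB.
have T0 : (0 <= (4 * n%:R * delta `^ gain)%:E * (S * singular3 kernel_order (p - q)%R))%E.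
  by nonneg.
(* Far pairs: the denominator is at least delta^(3+2s), and the triangle inequality bounds the
   remaining difference. *)
have [ed|ed] := leP delta e.
  apply: (le_trans _ (leeDl _ T0)); rewrite -EFinD -EFinM lee_fin powRN.
  have e0 : 0 < e := lt_le_trans d0 ed.
  rewrite ler_pdivrMr ?powR_gt0//.
  apply: (le_trans D2); rewrite -!mulrA ler_wpM2l// ler_wpM2l//.
  rewrite mulrCA; apply: (le_trans DA); rewrite ler_peMr// ?addr_ge0//.
  rewrite mulrC ler_pdivlMr ?powR_gt0// mul1r ge0_ler_powR ?nnegrE//; lra.
(* On the diagonal the numerator is 0, and so is the quotient. *)
have [pq|pq] := eqVneq p q.
  rewrite pq subrr expr0n/= mul0r adde_ge0//; last by rewrite -{1}pq.
  by nonneg.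
have h0 : p - q != 0 by rewrite subr_eq0.
have e0 : 0 < e by exact: enorm_gt0.
rewrite -[leLHS]add0e leeD//.
  by nonneg.
apply: (@le_trans _ _ ((2 * n%:R / e `^ (3 + 2 * s))%:E * D%:E)%E).
  by rewrite -EFinM lee_fin [leRHS]mulrAC ler_wpM2r ?invr_ge0 ?powR_ge0.
apply: (@le_trans _ _ ((2 * n%:R / e `^ (3 + 2 * s))%:E * ((2 * e `^ kernel_order)%:E * S))%E).
  by rewrite lee_wpmul2l//; nonneg.
rewrite muleA -EFinM.
have -> : 2 * n%:R / e `^ (3 + 2 * s) * (2 * e `^ kernel_order) =
    4 * n%:R * e `^ gain * e `^ (- (3 * kernel_order)).
  rewrite -powRN.
  have -> : 2 * n%:R * e `^ (- (3 + 2 * s)) * (2 * e `^ kernel_order) =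
    4 * n%:R * (e `^ (- (3 + 2 * s)) * e `^ kernel_order) by ring.
  rewrite -[RHS]mulrA -!powRD ?(gt_eqF e0) ?implybT//.
  by congr (_ * _ `^ _); rewrite /kernel_order /gain; field.
rewrite EFinM -muleA [X in (_ <= _ * X)%E]muleC; apply: lee_pmul.
- by nonneg.
- by nonneg.
- rewrite lee_fin ler_wpM2l ?mulr_ge0// ge0_ler_powR ?nnegrE ?(ltW e0) ?(ltW d0) ?(ltW ed)//.
  by rewrite /gain; lra.
- by rewrite lee_wpmul2r//; exact: powR_enorm_le_singular3 kernel_order01 _ h0.
Qed.

Lemma slobodeckij_le n v (delta : R) : profile kernel_order n v -> 0 < delta ->
  (slobodeckij s v <=
    (2 * n%:R * delta `^ (- (3 + 2 * s)))%:E *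
      (\int[lebesgue3 R]_(p in @Omega R) `|v p|%:E +
       \int[lebesgue3 R]_(p in @Omega R) `|v p|%:E) +
    (4 * n%:R * delta `^ gain *
      (singular_mass kernel_order ^+ 3 * (n%:R * singular_mass kernel_order)))%:E)%E.
Proof.
move=> [mv vn [cs csn vcs]] d0; set M := singular_mass kernel_order.
pose S p := (\sum_(c <- cs) singular kernel_order (coord c.1 p - c.2))%E.
pose leb := @lebesgue_measure R.
pose mu := sigma_finite_product (sigma_finite_product leb leb) leb.
have mSc (c : 'I_3 * R) :
    measurable_fun setT (fun p : R3 => singular kernel_order (coord c.1 p - c.2)).
  apply: (measurableT_comp (measurable_singular _)).
  by apply: measurable_funB => //; exact: measurable_coord.
have S0 p : (0 <= S p)%E by apply: sume_ge0 => c _; exact: singular_ge0.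
have mS : measurable_fun setT S by apply: emeasurable_sum => c; exact: mSc.
have M0 : 0 <= M.
  rewrite -lee_fin; apply: le_trans (integral_singular_coord kernel_order01 ord0 0).
  by apply: integral_ge0 => p _; exact: singular_ge0.
have intS : (\int[lebesgue3 R]_(p in @Omega R) S p <= (n%:R * M)%:E)%E.
  rewrite /S ge0_integral_sum//; last 3 first.
  - exact: measurable_Omega.
  - by move=> c; apply: measurable_funTS; exact: mSc.
  - by move=> c p _; exact: singular_ge0.
  apply: (@le_trans _ _ (\sum_(c <- cs) M%:E)%E).
    by apply: lee_sum => c _; exact: integral_singular_coord kernel_order01 _ _.
  by rewrite sumEFin lee_fin big_const_seq count_predT csn iter_addr_0 mulr_natl.
have msub1 : measurable_fun setT (fun z : R3 * R3 => enorm (z.1 - z.2)).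
  exact: measurableT_comp measurable_enorm measurable_sub_R3.
have a0 : 0 <= 2 * n%:R * delta `^ (- (3 + 2 * s)) by nonneg.
have b0 : 0 <= 4 * n%:R * delta `^ gain by nonneg.
apply: le_trans (_ : _ <= (2 * n%:R * delta `^ (- (3 + 2 * s)))%:E *
      (\int[lebesgue3 R]_(p in @Omega R) `|v p|%:E +
       \int[lebesgue3 R]_(p in @Omega R) `|v p|%:E) +
    (4 * n%:R * delta `^ gain)%:E *
      ((M ^+ 3)%:E * \int[lebesgue3 R]_(p in @Omega R) S p))%E _; last first.
  rewrite leeD2l// [in leRHS]EFinM lee_wpmul2l ?lee_fin// [leRHS]EFinM.
  by rewrite lee_wpmul2l// lee_fin exprn_ge0.
have H := (@double_integral_le _ _ R mu (@Omega R)
  (fun z => ((v z.1 - v z.2) ^+ 2 / enorm (z.1 - z.2) `^ (3 + 2 * s))%:E)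
  (fun z => singular3 kernel_order (z.1 - z.2)) (fun p => `|v p|%:E) S
  _ _ (M ^+ 3) (@measurable_Omega R) (@lebesgue3_Omega R) a0 b0).
refine (H _ _ _ _ _ _ _ _ _ _) => {H}.
- apply/measurable_EFinP; apply: measurable_funM.
    apply: measurable_funX; apply: measurable_funB; exact: measurableT_comp.
  rewrite (_ : (fun _ => _) = fun z : R3 * R3 =>
    enorm (z.1 - z.2) `^ (- (3 + 2 * s))).
    exact: measurableT_comp (measurable_powR _) msub1.
  by apply/funext => z; rewrite powRN.
- exact: measurableT_comp measurable_singular3 measurable_sub_R3.
- by apply/measurable_EFinP; exact: measurableT_comp.
- exact: mS.
- by move=> z; rewrite lee_fin mulr_ge0 ?sqr_ge0// invr_ge0 powR_ge0.
- by move=> z; exact: singular3_ge0.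
- by move=> z; rewrite lee_fin.
- exact: S0.
- by move=> p q; exact: (@slobodeckij_quotient_le n v (S p) delta p q (S0 p) vn d0 (vcs p q)).
- by move=> p; exact: integral_singular3 kernel_order01 _.
Qed.

End SlobodeckijBound.

Lemma L2sqnorm_ge0 (R : realType) (v : R * R * R -> R) : (0 <= L2sqnorm v)%E.
Proof. by apply: integral_ge0 => p _; rewrite lee_fin sqr_ge0. Qed.

Lemma slobodeckij_ge0 (R : realType) (theta : R) (v : R * R * R -> R) :
  (0 <= slobodeckij theta v)%E.
Proof.
pose leb := @lebesgue_measure R.
pose mu := sigma_finite_product (sigma_finite_product leb leb) leb.
refine (@integral_ge0 _ _ R (sigma_finite_product mu mu) _ _ _) => z _.
by rewrite lee_fin mulr_ge0 ?sqr_ge0// invr_ge0 powR_ge0.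
Qed.

Section SobolevSmall.
Variables (R : realType) (s : R).
Hypothesis s01 : 0 < s < 1 / 2.
Local Notation R3 := (R * R * R)%type.
Local Notation kernel_order := (kernel_order s).
Implicit Types (v : R3 -> R).

Lemma truncn_small : Num.truncn s = 0%N.
Proof.
have /andP[s0 s1] := s01; apply/eqP; rewrite -leqn0 -ltnS truncn_lt_nat ?ltW//.
by lra.
Qed.

Lemma sobolev_sqnormE (D : nat -> nat -> nat -> R3 -> R) :
  sobolev_sqnorm s D =
    (L2sqnorm (D 0%N 0%N 0%N) + slobodeckij s (D 0%N 0%N 0%N))%E.
Proof.
have /andP[s0 s1] := s01; rewrite /sobolev_sqnorm truncn_small subr0 s0.
by rewrite !big_ord1 !big_ord1_cond.
Qed.

Lemma L2sqnorm_le n v : measurable_fun setT v -> (forall p, `|v p| <= n%:R) ->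
  (L2sqnorm v <= n%:R%:E * \int[lebesgue3 R]_(p in @Omega R) `|v p|%:E)%E.
Proof.
move=> mv vn; have mO := @measurable_Omega R.
have mabs : measurable_fun (@Omega R) (fun p => `|v p|%:E).
  by apply/measurable_EFinP; apply: measurable_funTS; exact: measurableT_comp.
rewrite -ge0_integralZl_EFin//; apply: ge0_le_integral => //.
- by move=> p _; rewrite lee_fin sqr_ge0.
- by apply/measurable_EFinP; apply: measurable_funX; exact: measurable_funTS.
- exact: emeasurable_funM.
- by move=> p _; rewrite -EFinM lee_fin -real_normK ?num_real// expr2 ler_wpM2r.
Qed.

(** The threshold [d] depends on [n] and [e] but not on the singular centres. This uniformity is
    what later allows boxes with moving faces. *)
Lemma sobolev_sqnorm_small n (e : R) : 0 < e -> exists2 d : R, 0 < d &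
  forall v, profile kernel_order n v ->
    (\int[lebesgue3 R]_(p in @Omega R) `|v p|%:E < d%:E)%E ->
    (sobolev_sqnorm s (fun _ _ _ => v) < e%:E)%E.
Proof.
move=> e0; have /andP[s0 s1] := s01.
have g0 : 0 < gain s by rewrite /gain; lra.
pose C := 4 * n%:R * (singular_mass kernel_order ^+ 3 * (n%:R * singular_mass kernel_order)).
have M0 : 0 <= singular_mass kernel_order.
  rewrite -lee_fin; apply: le_trans (integral_singular_coord (kernel_order01 s01) ord0 0).
  by apply: integral_ge0 => p _; exact: singular_ge0.
have C0 : 0 <= C by rewrite /C !mulr_ge0 ?exprn_ge0.
pose t := e / (2 * (1 + C)).
have t0 : 0 < t by rewrite divr_gt0// mulr_gt0// ltr_pwDl.
(* Chosen so that delta^gain = t, which makes the part of the bound free of the L^1 norm equal to C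
   t < e / 2. Only then is the L^1 norm required to beat the large factor delta^-(3+2s) inside
   [K]. *)
pose delta := t `^ (gain s)^-1.
have delta0 : 0 < delta by rewrite powR_gt0.
have deltaE : delta `^ gain s = t.
  by rewrite -powRrM mulVf ?gt_eqF// powRr1// ltW.
have Ct : C * t < e / 2.
  rewrite /t mulrA ltr_pdivrMr ?mulr_gt0 ?ltr_pwDl//.
  by rewrite (_ : e / 2 * (2 * (1 + C)) = e + C * e); [lra|field].
pose K := 2 * n%:R * delta `^ (- (3 + 2 * s)).
have K0 : 0 <= K by rewrite /K !mulr_ge0 ?powR_ge0.
have n0 : 0 <= n%:R :> R by [].
have nK0 : 0 < 1 + n%:R + 2 * K by lra.
exists (e / 2 / (1 + n%:R + 2 * K)); first by rewrite !divr_gt0.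
move=> v pv; set I := (\int[_]_(_ in _) _)%E => Id.
have I0 : (0 <= I)%E by apply: integral_ge0 => p _; rewrite lee_fin.
rewrite sobolev_sqnormE.
have [mv vn _] := pv.
apply: (le_lt_trans (leeD (L2sqnorm_le mv vn) (slobodeckij_le s01 pv delta0))).
rewrite -/I -/K deltaE.
have -> : 4 * n%:R * t * (singular_mass kernel_order ^+ 3 * (n%:R * singular_mass kernel_order))
  = C * t by rewrite /C; ring.
have Ifin : I \is a fin_num by rewrite ge0_fin_numE// (lt_trans Id) ?ltry.
rewrite -(fineK Ifin) in Id I0 *; move: (fine I) Id I0 => x.
rewrite [X in (X < e%:E)%E](_ : _ = (n%:R * x + (K * (x + x) + C * t))%:E)//.
rewrite !lte_fin lee_fin => xd x0.
have : (n%:R + 2 * K) * x <= e / 2.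
  move: xd; rewrite ltr_pdivlMr// => xd.
  by rewrite (le_trans _ (ltW xd))// mulrC ler_wpM2l//; lra.
by lra.
Qed.

End SobolevSmall.

(** * Smooth approximations of box indicators *)

Section FlatFunctions.
Variable R : realType.
Implicit Types (P : {poly R}) (u v x y c m : R).

(** The classical functions that are flat at 0. The polynomial in 1/u makes the family closed under
    differentiation. *)
Definition flat P u : R := if 0 < u then P.[u^-1] * expR (- u^-1) else 0.

(** Induction along Horner's scheme, for all [n] at once: the step P X + c at [n] calls on P at
    [n.+1]. The constant term uses t^n <= n! exp t. *)
Lemma poly_le_expR P n : exists2 C : R, 0 <= C &
  forall t, 0 <= t -> `|P.[t]| * t ^+ n <= C * expR t.
Proof.
elim/poly_ind: P n => [|P c IH] n.
  by exists 0 => // t _; rewrite horner0 normr0 !mul0r.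
have [C C0 CP] := IH n.+1.
exists (C + `|c| * n`!%:R); first by rewrite addr_ge0// mulr_ge0.
move=> t t0; rewrite !hornerE mulrDl.
have tn : t ^+ n <= n`!%:R * expR t.
  case: n {IH CP} => [|n]; first by rewrite expr0 fact0 mul1r -expR0 ler_expR.
  rewrite -ler_pdivrMl ?ltr0n ?fact_gt0// mulrC.
  by apply: le_trans (expR_ge1Dxn n t0); rewrite lerDr.
apply: (@le_trans _ _ ((`|P.[t]| * t + `|c|) * t ^+ n)).
  rewrite ler_wpM2r ?exprn_ge0// (le_trans (ler_normD _ _))// normrM.
  by rewrite (ger0_norm t0).
rewrite mulrDl lerD//; first by rewrite -mulrA -exprS CP.
by rewrite -mulrA ler_wpM2l.
Qed.

Lemma is_derive_from_cvg (f : R -> R) x l :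
  (fun h => h^-1 *: ((f \o shift x) (h *: 1) - f x)) @ 0^' --> l ->
  is_derive x 1 f l.
Proof. by move=> fl; split; [apply/cvg_ex; exists l|exact: cvg_lim fl]. Qed.

(** For u > 0 the chain rule gives (P - P')(1/u) u^-2 exp(-1/u), and u^-2 is the value of X^2 at
    1/u. The substance is the point u = 0. *)
Lemma is_derive_flat P u :
  is_derive u 1 (flat P) (flat ('X ^+ 2 * (P - P^`())) u).
Proof.
have [u0|u0|->] := ltgtP u 0.
- apply: (@near_eq_is_derive _ _ _ (cst 0)).
    near=> w; rewrite /flat ltNge (_ : w <= 0)//.
    by rewrite ltW//; near: w; exact: lt_nbhsl.
  rewrite /flat ltNge (ltW u0)/=; exact: is_derive_cst.
- apply: (@near_eq_is_derive _ _ _ (fun w : R => P.[w^-1] * expR (- w^-1))).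
    near=> w; rewrite /flat ifT//.
    by near: w; exact: lt_nbhsr.
  rewrite /flat u0.
  have un0 : u != 0 by rewrite gt_eqF.
  have dV : is_derive u 1 (fun w : R => w^-1) (- u ^- 2).
    by have := @is_deriveV _ id u 1 1 un0 (is_derive_id _ _); rewrite /GRing.scale/= mulr1.
  have dP : is_derive u 1 (horner P \o (fun w => w^-1)) (P^`().[u^-1] * - u ^- 2).
    exact: is_derive1_comp.
  have dE : is_derive u 1 (expR \o (fun w => - w^-1)) (expR (- u^-1) * u ^- 2).
    apply: is_derive1_comp.
    by have := is_deriveN dV; rewrite opprK.
  have H : is_derive u 1 (fun w : R => P.[w^-1] * expR (- w^-1)) _ :=
    is_deriveM dP dE.
  apply: (is_derive_eq H).
  rewrite /GRing.scale/= hornerM hornerXn hornerD hornerN.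
  move: (expR _) P.[_] P^`().[_] => a b b'; by field.
(* With t = 1/h the quotient at 0 is t P(t) exp(-t). The bound |P(t)| t^2 <= C exp t makes it at
   most C h. *)
- have [C C0 CP] := poly_le_expR P 2.
  apply: is_derive_from_cvg; rewrite /flat ltxx.
  apply/cvgr0Pnorm_lt => e e0; near=> h.
  rewrite /= subr0 addr0 [_%:A]mulr1; case: ifPn => [h0|_]; last first.
    by rewrite scaler0 normr0.
  have CPh := CP h^-1 (ltW _); rewrite /GRing.scale/=.
  have : `|h^-1 * (P.[h^-1] * expR (- h^-1))| <= C * h.
    rewrite !normrM gtr0_norm ?invr_gt0// (gtr0_norm (expR_gt0 _)).
    rewrite mulrC expRN -mulrA -ler_pdivlMr ?mulr_gt0 ?invr_gt0 ?expR_gt0//.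
    rewrite invfM !invrK.
    have := CP h^-1; rewrite invr_ge0 => /(_ (ltW h0)).
    rewrite exprVn ler_pdivrMr ?exprn_gt0// => /le_trans; apply.
    by rewrite le_eqVlt; apply/orP; left; apply/eqP; ring.
  move=> /le_lt_trans; apply.
  have hd : `|h| < e / (1 + C).
    near: h; apply: dnbhs0_lt; rewrite divr_gt0// ltr_pwDl//.
  move: hd; rewrite gtr0_norm// ltr_pdivlMr ?ltr_pwDl// => hd.
  by apply: le_lt_trans hd; rewrite mulrC ler_wpM2l ?(ltW h0)// lerDr.
Unshelve. all: by end_near. Qed.

Lemma continuous_flat P : continuous (flat P).
Proof.
move=> u; apply/differentiable_continuous/derivable1_diffP.
by have [] := is_derive_flat P u.
Qed.

Lemma flat1E u : flat 1 u = if 0 < u then expR (- u^-1) else 0.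
Proof. by rewrite /flat hornerC mul1r. Qed.

Lemma flat1_01 u : 0 <= flat 1 u <= 1.
Proof.
rewrite flat1E; case: ifP => u0; last by rewrite lexx ler01.
by rewrite expR_ge0 -expR0 ler_expR oppr_le0 invr_ge0 ltW.
Qed.

(** If |u| <= 2 |u - v|, boundedness by 1 suffices. Otherwise u and v are positive with v > u / 2,
    and exp(-1/w) / w <= 1 controls the slope, unless both are nonpositive and the left side is
    0. *)
Lemma flat1_dist u v : `|flat 1 u - flat 1 v| * `|u| <= 2 * `|u - v|.
Proof.
have le1 : `|flat 1 u - flat 1 v| <= 1.
  by rewrite ler_distl; have := flat1_01 u; have := flat1_01 v; lra.
have far : `|u| <= 2 * `|u - v| -> `|flat 1 u - flat 1 v| * `|u| <= 2 * `|u - v|.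
  by apply: le_trans; rewrite ler_piMl.
have [u0|u0] := leP u 0.
  have [v0|v0] := leP v 0.
    by rewrite !flat1E !ltNge u0 v0 subrr normr0 mul0r mulr_ge0.
  by apply: far; rewrite !ler0_norm; lra.
have [v0|v0] := leP v (u / 2).
  by apply: far; rewrite !gtr0_norm; lra.
have v1 : 0 < v by lra.
(* Convexity in the form 1 + x <= exp x, with x = 1/w - 1/t. *)
have exp_le t w : 0 < t -> 0 < w -> t <= w ->
    `|flat 1 t - flat 1 w| <= expR (- w^-1) * ((w - t) / (t * w)).
  move=> t0 w0 tw; rewrite !flat1E t0 w0 distrC.
  have tw' : w^-1 <= t^-1 by rewrite lef_pV2 ?posrE.
  rewrite ger0_norm; last by rewrite subr_ge0 ler_expR; lra.
  have -> : - t^-1 = - w^-1 + (w^-1 - t^-1) by ring.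
  rewrite expRD -{1}[expR (- w^-1)]mulr1 -mulrBr ler_wpM2l ?expR_ge0//.
  have -> : (w - t) / (t * w) = t^-1 - w^-1 by field; rewrite !gt_eqF.
  by have := expR_ge1Dx (w^-1 - t^-1); lra.
have [uv|uv] := leP u v.
  rewrite (gtr0_norm u0) distrC (_ : `|u - v| = v - u); last by rewrite ler0_norm; lra.
  rewrite distrC; apply: (@le_trans _ _ (expR (- v^-1) * ((v - u) / (u * v)) * u)).
    by rewrite ler_wpM2r ?(ltW u0)// exp_le.
  have -> : expR (- v^-1) * ((v - u) / (u * v)) * u = (v^-1 * expR (- v^-1)) * (v - u).
    by field; rewrite !gt_eqF.
  rewrite ler_wpM2r ?subr_ge0//.
  rewrite expRN ler_pdivrMr ?expR_gt0//.
  have p0 : 0 < v^-1 by rewrite invr_gt0.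
  by have := expR_ge1Dx v^-1; lra.
rewrite (gtr0_norm u0) (_ : `|u - v| = u - v); last by rewrite gtr0_norm; lra.
rewrite distrC; apply: (@le_trans _ _ (expR (- u^-1) * ((u - v) / (v * u)) * u)).
  by rewrite ler_wpM2r ?(ltW u0)// exp_le// ltW.
have -> : expR (- u^-1) * ((u - v) / (v * u)) * u = (v^-1 * expR (- u^-1)) * (u - v).
  by field; rewrite !gt_eqF.
apply: ler_wpM2r; first by lra.
rewrite expRN ler_pdivrMr ?expR_gt0//.
(* The only place where v > u / 2 is used; it is the source of the factor 2 here. *)
have : v^-1 <= 2 * u^-1.
  have -> : 2 * u^-1 = (u / 2)^-1 by field; rewrite gt_eqF.
  by rewrite lef_pV2 ?posrE ?divr_gt0 ?ltW.
have p0 : 0 < u^-1 by rewrite invr_gt0.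
by have := expR_ge1Dx u^-1; lra.
Qed.

Lemma step_like_flat c m : m != 0 -> step_like c (fun x => flat 1 ((x - c) * m)).
Proof.
move=> m0; split.
- apply: continuous_measurable_fun => x.
  apply: (@continuous_comp _ _ _ (fun x => (x - c) * m)); last exact: continuous_flat.
  by apply: cvgM; [apply: cvgB; [exact: cvg_id|exact: cvg_cst]|exact: cvg_cst].
- by move=> x; exact: flat1_01.
- move=> x y; have := flat1_dist ((x - c) * m) ((y - c) * m).
  rewrite -mulrBl !normrM opprB addrA subrK => h.
  by rewrite -(ler_pM2r (_ : 0 < `|m|)) ?normr_gt0// -!mulrA.
Qed.

Lemma step_like_gt c : step_like c (fun x => (c < x)%R%:R).
Proof.
split.
- have -> : (fun x => (c < x)%R%:R) = \1_`]c, +oo[ :> (R -> R).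
    by apply/funext => x; rewrite indicE; congr (nat_of_bool _)%:R;
      apply/idP/idP; rewrite inE/= in_itv/= andbT.
  exact: measurable_indic.
- by move=> x; case: (c < x); rewrite ?lexx ler01.
- move=> x y; have [cx|cx] := ltP c x; have [cy|cy] := ltP c y => /=;
    rewrite ?subrr ?normr0 ?mul0r ?mulr_ge0// ?subr0 ?sub0r ?normrN normr1 mul1r.
  + by rewrite !gtr0_norm; lra.
  + by rewrite !ler0_norm; lra.
Qed.

Lemma step_like_lt c : step_like c (fun x => (x < c)%R%:R).
Proof.
split.
- have -> : (fun x => (x < c)%R%:R) = \1_`]-oo, c[ :> (R -> R).
    by apply/funext => x; rewrite indicE; congr (nat_of_bool _)%:R;
      apply/idP/idP; rewrite inE/= in_itv/=.
  exact: measurable_indic.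
- by move=> x; case: (x < c); rewrite ?lexx ler01.
- move=> x y; have [cx|cx] := ltP x c; have [cy|cy] := ltP y c => /=;
    rewrite ?subrr ?normr0 ?mul0r ?mulr_ge0// ?subr0 ?sub0r ?normrN normr1 mul1r.
  + by rewrite !ltr0_norm; lra.
  + by rewrite !ger0_norm; lra.
Qed.

End FlatFunctions.

(** * Smooth functions of compact support *)

Section TestFunctions.
Variable R : realType.
Local Notation R3 := (R * R * R)%type.
Implicit Types (g phi : R3 -> R) (p q : R3).

(* Chosen to be closed under partial derivatives, whence smoothness. *)
Inductive elementary : (R3 -> R) -> Prop :=
| elementary_flat P a c m : elementary (fun p => flat P ((coord a p - c) * m))
| elementary_cst c : elementary (fun=> c)
| elementary_add f g : elementary f -> elementary g ->
    elementary (fun p => f p + g p)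
| elementary_mul f g : elementary f -> elementary g ->
    elementary (fun p => f p * g p).

Lemma coordD a p q : coord a (p + q) = coord a p + coord a q.
Proof. by rewrite /coord; case: ifP => // _; case: ifP. Qed.

Lemma coordZ a (h : R) p : coord a (h *: p) = h * coord a p.
Proof. by rewrite /coord; case: ifP => // _; case: ifP. Qed.

Lemma coord_basis3 a b : coord b (basis3 R a) = (a == b)%:R.
Proof.
rewrite /coord /basis3; case: ifPn => [/eqP ->//|b0]; case: ifPn => [/eqP ->//|b1] /=.
congr (nat_of_bool (a == _))%:R; apply/val_inj => /=; rewrite inordK//.
move: b0 b1; rewrite -!val_eqE/= !inordK//.
by case: b => -[|[|[|]]].
Qed.

Lemma is_derive_elementary_flat P a c m p b :
  is_derive p (basis3 R b) (fun p => flat P ((coord a p - c) * m))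
    ((b == a)%:R * m * flat ('X ^+ 2 * (P - P^`())) ((coord a p - c) * m)).
Proof.
pose d : R := (b == a)%:R; set Q := 'X ^+ 2 * (P - P^`()).
have dline : is_derive (0 : R) 1 (fun h : R => (h * d + (coord a p - c)) * m) (d * m).
  have H : is_derive (0 : R) 1 (fun h : R => (h * d + (coord a p - c)) * m) _ :=
    is_deriveM (is_deriveD (is_deriveM (is_derive_id (0 : R) (1 : R))
      (is_derive_cst d (0 : R) (1 : R))) (is_derive_cst (coord a p - c) (0 : R) (1 : R)))
      (is_derive_cst m (0 : R) (1 : R)).
  apply: (is_derive_eq H).
  by rewrite /GRing.scale/=; ring.
have : is_derive (0 : R) 1
    (flat P \o (fun h : R => (h * d + (coord a p - c)) * m))
    (flat Q ((0 * d + (coord a p - c)) * m) * (d * m)).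
  exact: is_derive1_comp (is_derive_flat _ _) dline.
rewrite mul0r add0r => -[D1 D2].
(* Along the line through [p] in direction [b] the function is [flat P] after an affine map of [h],
   so its directional derivative is an ordinary derivative. *)
have lineE : (fun h : R => (fun p => flat P ((coord a p - c) * m)) (h *: basis3 R b + p)) =
    flat P \o (fun h : R => (h * d + (coord a p - c)) * m).
  by apply/funext => h /=; rewrite coordD coordZ coord_basis3 addrA.
split; first by apply/derivable1P; rewrite lineE.
rewrite mulrC -D2 -lineE /derive.
set u := fun h => h^-1 *: _; set w := fun h => h^-1 *: _.
suff -> : u = w by [].
by apply/funext => h; rewrite /u /w /= addr0 scale0r add0r [h%:A]mulr1.
Qed.

Lemma elementary_is_derive a g : elementary g ->
  exists2 g', elementary g' & forall p, is_derive p (basis3 R a) g (g' p).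
Proof.
elim=> [P b c m|c|f h ef [f' ef' df] eh [h' eh' dh]|f h ef [f' ef' df] eh [h' eh' dh]].
- eexists; last by move=> p; exact: is_derive_elementary_flat.
  exact: elementary_mul (elementary_cst _) (elementary_flat _ _ _ _).
- by exists (fun=> 0); [exact: elementary_cst|move=> p; exact: is_derive_cst].
- by exists (fun p => f' p + h' p); [exact: elementary_add|
    move=> p; exact: is_deriveD].
- exists (fun p => f p * h' p + h p * f' p).
    by apply: elementary_add; exact: elementary_mul.
  by move=> p; exact: is_deriveM.
Qed.

Lemma continuous_coord a : continuous (@coord R a).
Proof.
rewrite /coord; case: ifP => _ p; last case: ifP => _.
- by apply: (@continuous_comp _ _ _ fst fst); exact: cvg_fst.
- by apply: (@continuous_comp _ _ _ fst snd); [exact: cvg_fst|exact: cvg_snd].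
- exact: cvg_snd.
Qed.

Lemma elementary_continuous g : elementary g -> continuous g.
Proof.
elim=> [P a c m|c|f h _ cf _ ch|f h _ cf _ ch] p.
- apply: (@continuous_comp _ _ _ (fun p => (coord a p - c) * m)); last exact: continuous_flat.
  apply: cvgM; last exact: cvg_cst.
  by apply: cvgB; [exact: continuous_coord|exact: cvg_cst].
- exact: cvg_cst.
- by apply: cvgD; [exact: cf|exact: ch].
- by apply: cvgM; [exact: cf|exact: ch].
Qed.

Lemma elementary_pderiv l g : elementary g -> elementary (pderiv l g).
Proof.
move=> eg; elim: l => [//|a l IH] /=.
have [g' eg' dg] := elementary_is_derive a IH.
rewrite (_ : (fun p => _) = g')//; apply/funext => p.
by have [] := dg p.
Qed.

Lemma elementary_smooth g : elementary g -> smooth g.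
Proof.
move=> eg l; have el := elementary_pderiv l eg; split.
  exact: elementary_continuous.
by move=> a p; have [g' _ /(_ p)[]] := elementary_is_derive a el.
Qed.

Definition vanishes_near_boundary g : Prop :=
  exists2 e : R, 0 < e & forall p a, ~~ (e <= coord a p <= 1 - e) -> g p = 0.

Lemma elementary_test_function phi :
  elementary phi -> vanishes_near_boundary phi -> test_function phi.
Proof.
move=> ephi [e e0 phi0].
pose B := `[e, 1 - e] `*` `[e, 1 - e] `*` `[e, 1 - e] : set R3.
have cB : compact B.
  by apply: compact_setX; [apply: compact_setX|]; exact: segment_compact.
have clB : closed B.
  by apply: compact_closed cB; exact: norm_hausdorff.
have suppB : closure [set p | phi p != 0] `<=` B.
  rewrite [X in _ `<=` X](iffLR (closure_id B))//; apply: closureS => p /= phip.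
  have inB a : coord a p \in `[e, 1 - e].
    rewrite in_itv/=; apply: contraNT phip => pa; apply/eqP; exact: phi0 pa.
  have := inB (inord 0); have := inB (inord 1); have := inB (inord 2).
  by rewrite !coordE => h2 h1 h0; split; [split|].
split; first exact: elementary_smooth.
- by apply: subclosed_compact cB suppB; exact: closed_closure.
- move=> p /suppB[[/= h0 h1] h2]; move: h0 h1 h2; rewrite !in_itv/=.
  move=> /andP[a0 a1] /andP[b0 b1] /andP[c0 c1].
  by split; [split|]; rewrite /= in_itv/=; apply/andP; split; lra.
Qed.

End TestFunctions.

(** * Boxes and their mollifications *)

Section BoxApproximation.
Variable R : realType.
Local Notation R3 := (R * R * R)%type.
Local Notation J := ('I_3 * bool)%type.
Implicit Types (v w phi : R3 -> R) (p q l r : R3) (i : J).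

Definition corner l r i : R := coord i.1 (if i.2 then r else l).

Definition box_step l r i (x : R) : R :=
  (if i.2 then x < corner l r i else corner l r i < x)%R%:R.

Definition box l r : R3 -> R := tensor fst (box_step l r).

(** The box may stick out of the unit cube. Its faces are first clipped to the cube and then moved
    inwards by [e], so that the smooth box vanishes within distance [e] of the boundary. *)
Definition inner_corner l r (e : R) i : R :=
  if i.2 then Num.min (corner l r i) 1 - e else Num.max (corner l r i) 0 + e.

Definition smooth_step l r (e : R) i (x : R) : R :=
  flat 1 ((x - inner_corner l r e i) * (if i.2 then - e^-1 else e^-1)).

Definition smooth_box l r e : R3 -> R := tensor fst (smooth_step l r e).

Lemma card_faces : #|{: J}| = 6.
Proof. by rewrite card_prod card_ord card_bool. Qed.

Lemma box_step_like l r i : step_like (corner l r i) (box_step l r i).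
Proof.
by rewrite /box_step; case: i.2; [exact: step_like_lt|exact: step_like_gt].
Qed.

Lemma smooth_step_like l r e i : 0 < e ->
  step_like (inner_corner l r e i) (smooth_step l r e i).
Proof.
move=> e0; apply: step_like_flat.
by case: i.2; rewrite ?oppr_eq0 invr_eq0 gt_eqF.
Qed.

Lemma measurable_box l r : measurable_fun setT (box l r).
Proof. by apply: measurable_tensor => i; have [] := box_step_like l r i. Qed.

Lemma box01 l r p : 0 <= box l r p <= 1.
Proof.
have f01 i x : 0 <= box_step l r i x <= 1 by have [] := box_step_like l r i.
apply/andP; split; first by apply: prodr_ge0 => i _; have /andP[] := f01 i (coord i.1 p).
by apply: prodr_ile1 => i _; exact: f01.
Qed.

Lemma box_profile k l r : 0 < k < 1 -> profile k 6 (box l r).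
Proof.
move=> k01; have := @tensor_profile R k k01 J fst (corner l r) (box_step l r).
by rewrite card_faces; apply=> // i; exact: box_step_like.
Qed.

Lemma smooth_box_profile k l r e : 0 < k < 1 -> 0 < e ->
  profile k 6 (smooth_box l r e).
Proof.
move=> k01 e0.
have := @tensor_profile R k k01 J fst (inner_corner l r e) (smooth_step l r e).
by rewrite card_faces; apply=> // i; exact: smooth_step_like.
Qed.

Lemma integral_box_dist_le k l r l' r' (d : R) : 0 < k < 1 -> 0 < d ->
  (forall i, `|corner l r i - corner l' r' i| <= d) ->
  (\int[lebesgue3 R]_(p in @Omega R) `|box l r p - box l' r' p|%:E <=
    (6 * (2 * d `^ k * singular_mass k))%:E)%E.
Proof.
move=> k01 d0 lrd.
have := @integral_tensor_dist_le _ k k01 J fst (corner l r) (box_step l r)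
  (box_step l' r') d.
rewrite card_faces; apply => //.
- by move=> i; have [] := box_step_like l r i.
- by move=> i; have [] := box_step_like l' r' i.
- by move=> i x; have [] := box_step_like l r i.
- by move=> i x; have [] := box_step_like l' r' i.
(* The two indicators differ only between the two face positions, where x is within [d] of
   either. *)
- move=> i x; have := lrd i; rewrite /box_step.
  set c := corner l r i; set c' := corner l' r' i; clearbody c c'.
  move=> cc'; rewrite ler_distl in cc'.
  case: i.2.
    have [xc|xc] := ltP x c; have [xc'|xc'] := ltP x c' => /=;
      rewrite ?subrr ?normr0 ?mul0r ?mulr_ge0 ?(ltW d0)//
        ?subr0 ?sub0r ?normrN normr1 mul1r ler_distl; lra.
  have [xc|xc] := ltP c x; have [xc'|xc'] := ltP c' x => /=;
    rewrite ?subrr ?normr0 ?mul0r ?mulr_ge0 ?(ltW d0)//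
      ?subr0 ?sub0r ?normrN normr1 mul1r ler_distl; lra.
Qed.

(** Clipping leaves the box unchanged inside the cube and puts every face at distance exactly [e]
    from the matching face of the smooth box, as the comparison of the two requires. *)
Lemma box_clip l r : exists l' r', (forall p, Omega p -> box l r p = box l' r' p) /\
  forall e i, corner l' r' i + (if i.2 then - e else e) = inner_corner l r e i.
Proof.
exists (Num.max l.1.1 0, Num.max l.1.2 0, Num.max l.2 0).
exists (Num.min r.1.1 1, Num.min r.1.2 1, Num.min r.2 1).
have cl i : corner (Num.max l.1.1 0, Num.max l.1.2 0, Num.max l.2 0)
    (Num.min r.1.1 1, Num.min r.1.2 1, Num.min r.2 1) i =
    if i.2 then Num.min (corner l r i) 1 else Num.max (corner l r i) 0.
  rewrite /corner /coord; case: i => a b /=; case: b;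
  by case: ifP => // _; case: ifP.
split=> [p [[/= h0 h1] h2]|e i]; last by rewrite cl /inner_corner; case: i.2.
move: h0 h1 h2; rewrite !in_itv/= => /andP[? ?] /andP[? ?] /andP[? ?].
have p01 a : 0 < coord a p < 1.
  by rewrite /coord; case: ifP => // _; [|case: ifP => // _]; apply/andP.
apply: eq_bigr => i _; rewrite /box_step cl; have /andP[c0 c1] := p01 i.1.
by case: i.2; rewrite ?lt_min ?gt_max ?c0 ?c1 ?andbT.
Qed.

Lemma integral_smooth_box_dist_le k l r e : 0 < k < 1 -> 0 < e ->
  (\int[lebesgue3 R]_(p in @Omega R) `|box l r p - smooth_box l r e p|%:E <=
    (6 * (2 * e `^ k * singular_mass k))%:E)%E.
Proof.
move=> k01 e0; have [l' [r' [clip cE]]] := box_clip l r.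
under eq_integral => p /set_mem Op do rewrite (clip p Op).
have := @integral_tensor_dist_le _ k k01 J fst (corner l' r') (box_step l' r')
  (smooth_step l r e) e.
rewrite card_faces; apply => //.
- by move=> i; have [] := box_step_like l' r' i.
- by move=> i; have [] := smooth_step_like l r i e0.
- by move=> i x; have [] := box_step_like l' r' i.
- by move=> i x; have [] := smooth_step_like l r i e0.
- move=> i x; rewrite /box_step /smooth_step -cE.
  set c := corner l' r' i; clearbody c; rewrite flat1E.
  have einv : 0 < e^-1 by rewrite invr_gt0.
  (* [t] is the distance to the face, measured in units of [e]. *)
  have key (t : R) : 0 < t -> `|1 - (if 0 < t - 1 then expR (- (t - 1)^-1) else 0)| * t <= 2.
    move=> t0; have [t1|t1] := ltP 0 (t - 1); last by rewrite subr0 normr1; lra.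
    have t10 : 0 < (t - 1)^-1 by rewrite invr_gt0.
    have eE := expR_ge1Dx (- (t - 1)^-1).
    have e1 : expR (- (t - 1)^-1) <= 1 by rewrite -[leRHS]expR0 ler_expR; lra.
    rewrite ger0_norm ?subr_ge0//.
    (* Up to t = 2 the first factor is at most 1. Beyond, 1 - exp(-y) <= y with y = 1/(t-1), and t
       <= 2 (t - 1). *)
    have [t2|t2] := leP t 2.
      by apply: (le_trans _ t2); rewrite ler_piMl ?(ltW t0)// lerBlDr lerDl expR_ge0.
    apply: (@le_trans _ _ ((t - 1)^-1 * t)); first by rewrite ler_wpM2r; lra.
    by rewrite mulrC ler_pdivrMr//; lra.
  case: i.2.
  - have -> : (x - (c + - e)) * - e^-1 = (c - x) / e - 1 by field; rewrite gt_eqF.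
    have [xc|xc] := ltP x c; last first.
      have ce : (c - x) / e <= 0 by rewrite pmulr_lle0; lra.
      by rewrite ifF ?subrr ?normr0 ?mul0r ?mulr_ge0 ?(ltW e0)//; apply/negP; lra.
    have ce : 0 < (c - x) / e by rewrite divr_gt0; lra.
    have := key _ ce; rewrite mulrA ler_pdivrMr// => /le_trans h.
    by rewrite (_ : `|x - c| = c - x); [exact: h|rewrite ltr0_norm; lra].
  - have -> : (x - (c + e)) * e^-1 = (x - c) / e - 1 by field; rewrite gt_eqF.
    have [xc|xc] := ltP c x; last first.
      have ce : (x - c) / e <= 0 by rewrite pmulr_lle0; lra.
      by rewrite ifF ?subrr ?normr0 ?mul0r ?mulr_ge0 ?(ltW e0)//; apply/negP; lra.
    have ce : 0 < (x - c) / e by rewrite divr_gt0; lra.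
    have := key _ ce; rewrite mulrA ler_pdivrMr// => /le_trans h.
    by rewrite (_ : `|x - c| = x - c); [exact: h|rewrite gtr0_norm; lra].
Qed.

Lemma smooth_box_elementary l r e : elementary (smooth_box l r e).
Proof.
rewrite /smooth_box /tensor.
rewrite (_ : (fun p => _) = fun p => \prod_(i <- enum {: J}) smooth_step l r e i (coord i.1 p)).
  elim: (enum _) => [|i s IH].
    by under eq_fun do rewrite big_nil; exact: elementary_cst.
  under eq_fun do rewrite big_cons.
  by apply: elementary_mul IH; exact: elementary_flat.
by apply/funext => p; rewrite big_enum.
Qed.

Lemma smooth_box_vanishes l r e : 0 < e -> vanishes_near_boundary (smooth_box l r e).
Proof.
move=> e0; exists e => // p a pa.
have einv : 0 < e^-1 by rewrite invr_gt0.
suff [i i0] : exists i, smooth_step l r e i (coord i.1 p) = 0.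
  by rewrite /smooth_box /tensor (bigD1 i)//= i0 mul0r.
rewrite negb_and -!ltNge in pa; have {pa} [pa|pa] := orP pa.
- exists (a, false); rewrite /smooth_step flat1E ifF// pmulr_lgt0//=.
  apply/negP; have : 0 <= Num.max (corner l r (a, false)) 0 by rewrite le_max lexx orbT.
  by rewrite /inner_corner/=; lra.
- exists (a, true); rewrite /smooth_step flat1E ifF//= mulrN oppr_gt0 pmulr_llt0//.
  apply/negP; have : Num.min (corner l r (a, true)) 1 <= 1 by rewrite ge_min lexx orbT.
  by rewrite /inner_corner/=; lra.
Qed.

End BoxApproximation.

(** * Continuity of the convolutions *)

Section SobolevMembership.
Variables (R : realType) (s : R).
Hypothesis s01 : 0 < s < 1 / 2.
Local Notation R3 := (R * R * R)%type.
Local Notation k := (kernel_order s).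
Implicit Types (v w phi : R3 -> R) (p q l r : R3).

Lemma mul_powR_small (C d x : R) : 0 <= C -> 0 < d -> 0 < x ->
  exists2 e : R, 0 < e & C * e `^ x < d.
Proof.
move=> C0 d0 x0; have C1 : 0 < 1 + C by rewrite ltr_pwDl.
have t0 : 0 < d / (1 + C) by rewrite divr_gt0.
exists ((d / (1 + C)) `^ x^-1); first by rewrite powR_gt0.
rewrite -powRrM mulVf ?gt_eqF// powRr1 ?(ltW t0)//.
by rewrite mulrA ltr_pdivrMr// mulrC ltr_pM2l// ltrDr.
Qed.

(** One [n] serves [v] and all its approximants. The differences then have profile [n + n], and
    convergence in L^1 upgrades to convergence in H^s. *)
Definition approximable v : Prop := exists2 n, profile k n v &
  forall d : R, 0 < d -> exists phi, [/\ elementary phi,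
    vanishes_near_boundary phi, profile k n phi &
    (\int[lebesgue3 R]_(p in @Omega R) `|v p - phi p|%:E < d%:E)%E].

Lemma approximable_box l r : approximable (box l r).
Proof.
have k01 := kernel_order01 s01; have /andP[k0 k1] := k01.
have M0 : 0 <= singular_mass k.
  rewrite -lee_fin; apply: le_trans (integral_singular_coord k01 ord0 0).
  by apply: integral_ge0 => p _; exact: singular_ge0.
exists 6%N; first exact: box_profile.
move=> d d0; have C0 : 0 <= 12 * singular_mass k by rewrite mulr_ge0.
have [e e0 ed] := mul_powR_small C0 d0 k0.
exists (smooth_box l r e); split.
- exact: smooth_box_elementary.
- exact: smooth_box_vanishes.
- exact: smooth_box_profile.
- apply: le_lt_trans (integral_smooth_box_dist_le _ _ k01 e0) _.
  by rewrite lte_fin; lra.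
Qed.

Lemma elementaryB f g : elementary f -> elementary g ->
  elementary (fun p : R3 => f p - g p).
Proof.
move=> ef eg; rewrite (_ : (fun p => _) = fun p => f p + -1 * g p).
  by apply: elementary_add => //; apply: elementary_mul => //; exact: elementary_cst.
by apply/funext => p; rewrite mulN1r.
Qed.

Lemma vanishes_near_boundaryB f g :
  vanishes_near_boundary f -> vanishes_near_boundary g ->
  vanishes_near_boundary (fun p : R3 => f p - g p).
Proof.
move=> [e e0 fe] [d d0 gd]; exists (Num.min e d); first by rewrite lt_min e0.
move=> p a pa.
have le_e : Num.min e d <= e by rewrite ge_min lexx.
have le_d : Num.min e d <= d by rewrite ge_min lexx orbT.
rewrite (fe p a) ?(gd p a) ?subrr//; apply: contra pa => /andP[? ?].
  by apply/andP; split; lra.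
by apply/andP; split; lra.
Qed.

Lemma integral_abs_triangle v w (f g : R3 -> R) :
  measurable_fun setT v -> measurable_fun setT w ->
  measurable_fun setT f -> measurable_fun setT g ->
  (\int[lebesgue3 R]_(p in @Omega R) `|v p - w p - (f p - g p)|%:E <=
   \int[lebesgue3 R]_(p in @Omega R) `|v p - f p|%:E +
   \int[lebesgue3 R]_(p in @Omega R) `|w p - g p|%:E)%E.
Proof.
move=> mv mw mf mg; have mO := @measurable_Omega R.
have mabs (f1 f2 : R3 -> R) : measurable_fun setT f1 -> measurable_fun setT f2 ->
    measurable_fun (@Omega R) (fun p : R3 => `|f1 p - f2 p|%:E).
  move=> m1 m2; apply/measurable_EFinP; apply: measurable_funTS.
  by apply: measurableT_comp => //; exact: measurable_funB.
rewrite -ge0_integralD//; try exact: mabs.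
apply: ge0_le_integral => //.
- by apply: mabs; exact: measurable_funB.
- by apply: emeasurable_funD; exact: mabs.
- move=> p _; rewrite -EFinD lee_fin.
  by rewrite (_ : _ - (_ - _) = v p - f p - (w p - g p)) ?ler_normB//; ring.
Qed.

Lemma approximableB v w : approximable v -> approximable w ->
  approximable (fun p => v p - w p).
Proof.
move=> [m pv av] [n pw aw]; exists (m + n)%N; first exact: profileB.
move=> d d0; have d20 : 0 < d / 2 by rewrite divr_gt0.
have [phi [ephi vphi pphi iphi]] := av _ d20.
have [psi [epsi vpsi ppsi ipsi]] := aw _ d20.
exists (fun p => phi p - psi p); split.
- exact: elementaryB.
- exact: vanishes_near_boundaryB.
- exact: profileB.
- have [mv _ _] := pv; have [mw _ _] := pw; have [mphi _ _] := pphi.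
  have [mpsi _ _] := ppsi.
  apply: (le_lt_trans (integral_abs_triangle mv mw mphi mpsi)).
  by rewrite (splitr d) EFinD lteD.
Qed.

Lemma eq_sobolev_sqnorm v w : (forall p, Omega p -> v p = w p) ->
  sobolev_sqnorm s (fun _ _ _ => v) = sobolev_sqnorm s (fun _ _ _ => w).
Proof.
move=> vw; rewrite !sobolev_sqnormE//; congr (_ + _)%E.
  by apply: eq_integral => p /set_mem Op; rewrite vw.
pose leb := @lebesgue_measure R.
pose mu := sigma_finite_product (sigma_finite_product leb leb) leb.
refine (@eq_integral _ _ R (sigma_finite_product mu mu) _ _ _ _).
by move=> z /set_mem[/= O1 O2]; rewrite !vw.
Qed.

Lemma sobolev_sqnorm_ge0 v : (0 <= sobolev_sqnorm s (fun _ _ _ => v))%E.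
Proof.
by rewrite sobolev_sqnormE// adde_ge0 ?L2sqnorm_ge0 ?slobodeckij_ge0.
Qed.

Lemma sobolev_sqnorm_lty n v : profile k n v ->
  (sobolev_sqnorm s (fun _ _ _ => v) < +oo)%E.
Proof.
move=> pv; have [mv vn _] := pv; rewrite sobolev_sqnormE//.
apply: (le_lt_trans (leeD (L2sqnorm_le mv vn) (slobodeckij_le s01 pv ltr01))).
have In : (\int[lebesgue3 R]_(p in @Omega R) `|v p|%:E < +oo)%E.
  apply: (@le_lt_trans _ _ (\int[lebesgue3 R]_(p in @Omega R) (n%:R)%:E)%E).
    apply: ge0_le_integral => //; first exact: measurable_Omega.
      by apply/measurable_EFinP; apply: measurable_funTS; exact: measurableT_comp.
    by move=> p _; rewrite lee_fin.
  rewrite integral_cst; last exact: measurable_Omega.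
  by rewrite [X in (_ * X)%E](@lebesgue3_Omega R) mule1 ltry.
have I0 : (0 <= \int[lebesgue3 R]_(p in @Omega R) `|v p|%:E)%E.
  by apply: integral_ge0 => p _; rewrite lee_fin.
have nonneg_fin (c : R) : (0 <= c)%R ->
    (c%:E * \int[lebesgue3 R]_(p in @Omega R) `|v p|%:E < +oo)%E.
  by move=> c0; rewrite lte_mul_pinfty.
have c0 : 0 <= 2 * n%:R * 1 `^ (- (3 + 2 * s)) by rewrite !mulr_ge0 ?powR_ge0.
apply: lte_add_pinfty; first exact: nonneg_fin.
apply: lte_add_pinfty; last exact: ltry.
by rewrite ge0_muleDr//; apply: lte_add_pinfty; exact: nonneg_fin.
Qed.

(** For 0 < s < 1 only the multi-index 0 enters, so the constant family at [w] is a jet. The passage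
    from [v] to [w] admits indicators cut off by zero outside Omega, which are what a functional is
    applied to. *)
Lemma approximable_sobolev0 v w : approximable v ->
  (forall p, Omega p -> w p = v p) ->
  sobolev_jet s w (fun _ _ _ => w) /\ sobolev0 s w.
Proof.
move=> [n pv av] wv.
have jet : sobolev_jet s w (fun _ _ _ => w).
  split=> //; last by rewrite (eq_sobolev_sqnorm wv); exact: sobolev_sqnorm_lty pv.
  move=> i j l; rewrite truncn_small// leqn0 !addn_eq0 => /andP[/andP[/eqP-> /eqP->] /eqP->].
  split.
    have [mv _ _] := pv; apply: eq_measurable_fun (measurable_funTS mv).
    by move=> p /set_mem Op; rewrite wv.
  by move=> phi _; rewrite /mderiv/= expr0 mul1r.
split=> //; exists (fun _ _ _ => w) => // e e0.
have [d d0 small] := sobolev_sqnorm_small s01 (n + n) (exprn_gt0 2 e0).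
have [phi [ephi vphi pphi iphi]] := av d d0.
exists phi; first exact: elementary_test_function.
apply: le_lt_trans (small _ (profileB pv pphi) iphi).
(* The norm reads only the component (0, 0, 0), where [mderiv 0 0 0 phi] is [phi]. *)
rewrite sobolev_sqnormE// -(sobolev_sqnormE s01 (fun _ _ _ p => w p - phi p)).
rewrite (@eq_sobolev_sqnorm (fun p => w p - phi p) (fun p => v p - phi p))//.
by move=> p Op; rewrite wv.
Qed.

End SobolevMembership.

Section Convolution.
Variable R : realType.
Local Notation R3 := (R * R * R)%type.
Implicit Types (p q l r t : R3).

Lemma boxE l r t :
  box l r t = \1_[set t | forall a, coord a l < coord a t < coord a r] t.
Proof.
rewrite indicE; case: (asboolP (forall a, coord a l < coord a t < coord a r)) => [inb|outb].
  rewrite mem_set// /box /tensor big1// => -[a b] _.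
  have /andP[la ra] := inb a.
  by rewrite /box_step /corner/=; case: b; rewrite ?la ?ra.
rewrite memNset//; have /existsNP[a /negP] := outb.
rewrite negb_and => /orP[la|ra].
  rewrite /box /tensor (bigD1 (a, false))//= /box_step /corner/=.
  by rewrite (negbTE la) mul0r.
rewrite /box /tensor (bigD1 (a, true))//= /box_step /corner/=.
by rewrite (negbTE ra) mul0r.
Qed.

Lemma coord_norm_le a p : `|coord a p| <= `|p|.
Proof.
case: p => [[x y] z]; rewrite /coord !prod_normE/= !le_max.
by case: ifP => _ /=; [|case: ifP => _ /=]; rewrite lexx ?orbT.
Qed.

Lemma box_shift_small (a b p : R3) (d : R) : 0 < d -> \forall q \near p,
  (\int[lebesgue3 R]_(t in @Omega R)
     `|box (p - a) (p + b) t - box (q - a) (q + b) t|%:E < d%:E)%E.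
Proof.
(* Any exponent in (0, 1) would do here, as only an L^1 norm is estimated. *)
move=> d0; have k01 : 0 < (1 / 2 : R) < 1 by apply/andP; split; lra.
have M0 : 0 <= singular_mass (1 / 2 : R).
  rewrite -lee_fin; apply: le_trans (integral_singular_coord k01 ord0 0).
  by apply: integral_ge0 => t _; exact: singular_ge0.
have C0 : 0 <= 12 * singular_mass (1 / 2 : R) by rewrite mulr_ge0.
have [e e0 ed] := mul_powR_small C0 d0 (proj1 (andP k01)).
near=> q; apply: le_lt_trans (_ : _ <= (6 * (2 * e `^ (1 / 2) *
    singular_mass (1 / 2)))%:E)%E _; last by rewrite lte_fin; lra.
apply: integral_box_dist_le => // i.
have pqe : `|p - q| <= e.
  by near: q; apply: cvgr_dist_le => //; exact: cvg_id.
apply: le_trans pqe; rewrite /corner; case: i.2; rewrite -coordB.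
  rewrite (_ : p + b - (q + b) = p - q); first exact: coord_norm_le.
  by rewrite opprD addrACA subrr addr0.
rewrite (_ : p - a - (q - a) = p - q); first exact: coord_norm_le.
by rewrite opprB addrA subrK.
Unshelve. all: by end_near. Qed.

Variables (chi : R3 -> R) (a b : R3).
Hypothesis chiE : forall p t, chi (p - t) = box (p - a) (p + b) t.

(** The difference of two boxes has twelve jump planes whatever [q] is. The threshold [d] can thus
    be fixed before [q], and continuity of translation in L^1 does the rest. *)
Lemma convolution_functional_continuous (s : R) F : 0 < s < 1 / 2 ->
  sobolev0_dual s F -> continuous (convolution chi (Functional F)).
Proof.
move=> s01 [Flin [C FC]] p; rewrite /convolution.
pose g p := (fun t => chi (p - t)) \_ (@Omega R).
have gE q t : Omega t -> g q t = box (q - a) (q + b) t.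
  by move=> Ot; rewrite /g patchE mem_set.
have appr q : approximable s (box (q - a) (q + b)) by exact: approximable_box.
have g0 q : sobolev0 s (g q).
  by have [] := approximable_sobolev0 s01 (appr q) (gE q).
apply/cvgrPdist_lt => e e0.
have C1 : 0 < 1 + `|C| by rewrite ltr_pwDl.
have e10 : 0 < e / (1 + `|C|) by rewrite divr_gt0.
have [d d0 small] := sobolev_sqnorm_small s01 12 (exprn_gt0 2 e10).
near=> q.
have near_q : (\int[lebesgue3 R]_(t in @Omega R)
    `|box (p - a) (p + b) t - box (q - a) (q + b) t|%:E < d%:E)%E.
  by near: q; exact: box_shift_small.
pose v t := box (p - a) (p + b) t - box (q - a) (q + b) t.
(* Written in the shape a u + v in which linearity of [F] is assumed. *)
pose w t := -1 * g q t + g p t.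
have wv t : Omega t -> w t = v t by move=> Ot; rewrite /w !gE// /v; ring.
have [jet w0] := approximable_sobolev0 s01 (approximableB (appr p) (appr q)) wv.
have -> : F (g p) - F (g q) = F w by rewrite /w Flin//; ring.
have pv : profile (kernel_order s) 12 v.
  have k01 := kernel_order01 s01.
  exact: (profileB (box_profile _ _ k01) (box_profile _ _ k01)).
have := small v pv near_q; rewrite -(eq_sobolev_sqnorm s01 wv) => sw.
apply: le_lt_trans (FC _ _ w0 jet) _.
have sw0 := sobolev_sqnorm_ge0 s01 w.
have nw : sobolev_norm s (fun _ _ _ => w) < e / (1 + `|C|).
  rewrite /sobolev_norm -(ger0_norm (ltW e10)) -sqrtr_sqr ltr_sqrt ?exprn_gt0//.
  by rewrite -lte_fin fineK// ge0_fin_numE// (lt_trans sw) ?ltry.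
apply: (@le_lt_trans _ _ (`|C| * sobolev_norm s (fun _ _ _ => w))).
  by rewrite ler_wpM2r ?sqrtr_ge0// ler_norm.
apply: (@le_lt_trans _ _ (`|C| * (e / (1 + `|C|)))); first by rewrite ler_wpM2l// ltW.
by rewrite mulrA ltr_pdivrMr// mulrC ltr_pM2l// ltrDr.
Unshelve. all: by end_near. Qed.

Lemma convolution_function_continuous (u : R3 -> R) :
  measurable_fun (@Omega R) u -> (L2sqnorm u < +oo)%E ->
  continuous (convolution chi (Function u)).
Proof.
move=> mu_ u2 p; have mO := @measurable_Omega R.
have u20 : (0 <= L2sqnorm u)%E by apply: integral_ge0 => t _; rewrite lee_fin sqr_ge0.
have u2fin : L2sqnorm u \is a fin_num by rewrite ge0_fin_numE.
pose U := fine (L2sqnorm u).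
have U0 : 0 <= U by exact: fine_ge0.
have mbox q : measurable_fun (@Omega R) (box (q - a) (q + b)).
  by apply: measurable_funTS; exact: measurable_box.
(* An integrable majorant for the box indicator times [u]: |u| <= 1 + u^2, and Omega has measure
   1. *)
have iu2 : (lebesgue3 R).-integrable (@Omega R) (fun t => (1 + u t ^+ 2)%:E).
  rewrite (_ : (fun t => _) = (fun t => 1%:E + (u t ^+ 2)%:E)%E)//.
  apply: integrableD => //.
    apply/integrableP; split; first exact: measurable_cst.
    rewrite integral_cst//; rewrite [X in (_ * X)%E](@lebesgue3_Omega R) mule1.
    by rewrite /= normr1 ltry.
  apply/integrableP; split; first by apply/measurable_EFinP; exact: measurable_funX.
  by under eq_integral => t _ do rewrite /= ger0_norm ?sqr_ge0//.
have ibu q : (lebesgue3 R).-integrable (@Omega R)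
    (EFin \o (fun t => box (q - a) (q + b) t * u t)).
  apply: (le_integrable _ _ _ iu2) => //.
    by apply/measurable_EFinP; exact: measurable_funM (mbox q) mu_.
  move=> t _; rewrite /= lee_fin normrM.
  have /andP[b0 b1] := box01 (q - a) (q + b) t.
  rewrite (ger0_norm b0) [leRHS]ger0_norm ?addr_ge0 ?sqr_ge0//.
  apply: (@le_trans _ _ `|u t|); first by rewrite ler_piMl.
  rewrite -(real_normK (num_real (u t))).
  by have := sqr_ge0 (`|u t| - 1); have := sqr_ge0 `|u t|; lra.
have convE q : convolution chi (Function u) q =
    \int[lebesgue3 R]_(t in @Omega R) (box (q - a) (q + b) t * u t).
  rewrite /convolution [RHS]Rintegral_mkcond; apply: eq_Rintegral => t _.
  by rewrite /= !patchE chiE; case: ifP; rewrite ?mulr0.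
apply/cvgrPdist_lt => e e0.
(* With this weight the u^2 term is U / (2T) <= e / 2, and an L^1 distance below e / T keeps the
   other term below e / 2. *)
have [T T0 TE] : exists2 T : R, 0 < T & T * e = U + 1.
  by exists ((U + 1) / e); rewrite ?divfK ?gt_eqF// divr_gt0// ltr_wpDl.
have T20 : 0 <= T / 2 by rewrite divr_ge0 ?ltW.
have TV0 : 0 <= (2 * T)^-1 by rewrite invr_ge0 mulr_ge0 ?ltW.
have d0 : 0 < e / T by rewrite divr_gt0.
near=> q.
have near_q : (\int[lebesgue3 R]_(t in @Omega R)
    `|box (p - a) (p + b) t - box (q - a) (q + b) t|%:E < (e / T)%:E)%E.
  by near: q; exact: box_shift_small.
rewrite !convE -RintegralB//.
pose v t := box (p - a) (p + b) t - box (q - a) (q + b) t.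
have mv : measurable_fun (@Omega R) v by exact: measurable_funB.
have -> : \int[lebesgue3 R]_(t in @Omega R) (box (p - a) (p + b) t * u t -
    box (q - a) (q + b) t * u t) = \int[lebesgue3 R]_(t in @Omega R) (v t * u t).
  by apply: eq_Rintegral => t _; rewrite /v mulrBl.
have ivu : (lebesgue3 R).-integrable (@Omega R) (EFin \o (fun t => v t * u t)).
  pose B q t := box (q - a) (q + b) t * u t.
  have -> : EFin \o (fun t => v t * u t) =
      (fun t => (EFin \o B p) t - (EFin \o B q) t)%E.
    by apply/funext => t; rewrite /= -EFinB -mulrBl.
  apply: integrableB; [exact: mO|exact: ibu|exact: ibu].
apply: (@le_lt_trans _ _ (\int[lebesgue3 R]_(t in @Omega R) `|v t * u t|)).
  by apply: le_normr_Rintegral; [exact: mO|exact: ivu].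
have mvu : measurable_fun (@Omega R) (fun t => `|v t * u t|%:E).
  by apply/measurable_EFinP; apply: measurableT_comp => //; exact: measurable_funM.
have mav : measurable_fun (@Omega R) (fun t => `|v t|%:E).
  by apply/measurable_EFinP; exact: measurableT_comp.
have mau : measurable_fun (@Omega R) (fun t => (u t ^+ 2)%:E).
  by apply/measurable_EFinP; exact: measurable_funX.
(* AM-GM: [2 |v u| <= T v^2 + u^2 / T], and [v^2 <= |v|] since [|v| <= 1] *)
have le_int : (\int[lebesgue3 R]_(t in @Omega R) `|v t * u t|%:E <=
    (T / 2)%:E * \int[lebesgue3 R]_(t in @Omega R) `|v t|%:E +
    (2 * T)^-1%:E * L2sqnorm u)%E.
  rewrite -ge0_integralZl_EFin// -ge0_integralZl_EFin; try solve
    [ by [] | by move=> t _; rewrite lee_fin sqr_ge0 ].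
  rewrite -ge0_integralD; try solve
    [ by [] | exact: emeasurable_funM
    | by move=> t _; rewrite -EFinM lee_fin mulr_ge0 ?sqr_ge0 ].
  apply: ge0_le_integral => //.
    by apply: emeasurable_funD; exact: emeasurable_funM.
  move=> t _; rewrite -!EFinM -EFinD lee_fin normrM.
  have v1 : `|v t| <= 1.
    rewrite ler_distl; have := box01 (p - a) (p + b) t.
    by have := box01 (q - a) (q + b) t; lra.
  have v2 : `|v t| ^+ 2 <= `|v t| by rewrite expr2 ler_piMl.
  rewrite -(real_normK (num_real (u t))).
  move: `|v t| `|u t| (normr_ge0 (v t)) v2 => x y x0 x2.
  have -> : T / 2 * x + (2 * T)^-1 * y ^+ 2 = (T ^+ 2 * x + y ^+ 2) / (2 * T).
    by field; rewrite gt_eqF.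
  rewrite ler_pdivlMr ?mulr_gt0//.
  have : T ^+ 2 * x ^+ 2 <= T ^+ 2 * x by rewrite ler_wpM2l// exprn_ge0// ltW.
  by have := sqr_ge0 (T * x - y); lra.
rewrite -lte_fin /Rintegral fineK; last first.
  rewrite ge0_fin_numE; last by apply: integral_ge0 => t _; rewrite lee_fin.
  apply: le_lt_trans le_int _; apply: lte_add_pinfty.
    rewrite lte_mul_pinfty ?lee_fin//.
    exact: lt_trans near_q (ltry _).
  by rewrite lte_mul_pinfty ?lee_fin.
apply: le_lt_trans le_int _.
have -> : e%:E = ((T / 2)%:E * (e / T)%:E + (e / 2)%:E)%E.
  by rewrite -EFinM -EFinD; congr EFin; field; rewrite gt_eqF.
apply: lte_leD.
- by rewrite -(fineK u2fin) -EFinM.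
- by rewrite lte_pmul2l// lte_fin divr_gt0.
- rewrite -(fineK u2fin) -EFinM lee_fin -/U mulrC ler_pdivrMr ?mulr_gt0//.
  have -> : e / 2 * (2 * T) = U + 1 by rewrite -TE; field.
  by rewrite lerDl.
Unshelve. all: by end_near. Qed.

End Convolution.

Section ConvolutionOfCells.
Variable R : realType.
Local Notation R3 := (R * R * R)%type.

Lemma cell_chi_box (X Y Z : grid R) (i j k : nat) (p t : R3) :
  cell_chi X Y Z i j k (p - t) =
  box (p - (step X i / 2, step Y j / 2, step Z k / 2))
      (p + (step X i.+1 / 2, step Y j.+1 / 2, step Z k.+1 / 2)) t.
Proof.
rewrite boxE /cell_chi !indicE; congr (nat_of_bool _)%:R.
apply/idP/idP; rewrite !inE.
- move=> [[h0 h1] h2] a; move: h0 h1 h2; rewrite /half_cell/= !in_itv/=.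
  move=> /andP[x0 x1] /andP[y0 y1] /andP[z0 z1].
  by rewrite /coord; case: ifP => _; [|case: ifP => _]; rewrite /=; apply/andP; split; lra.
- move=> h; have := h (inord 0); have := h (inord 1); have := h (inord 2).
  rewrite !coordE/= => /andP[z0 z1] /andP[y0 y1] /andP[x0 x1].
  by split; [split|]; rewrite /half_cell/= in_itv/=; apply/andP; split; lra.
Qed.

Lemma sobolev_jet_L2 (s : R) (u : R3 -> R) D : sobolev_jet s u D ->
  measurable_fun (@Omega R) u /\ (L2sqnorm u < +oo)%E.
Proof.
move=> [D0 wD sD]; split.
  by have [] := wD 0%N 0%N 0%N (leq0n _); rewrite D0.
apply: le_lt_trans sD; rewrite -D0 /sobolev_sqnorm.
have L0 := @L2sqnorm_ge0 R; have sl0 := @slobodeckij_ge0 R.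
rewrite -[leLHS]adde0; apply: leeD; last first.
  by case: ifP => // _; do 3![apply: sume_ge0 => ? _].
rewrite big_ord_recl -[leLHS]adde0; apply: leeD; last by do 3![apply: sume_ge0 => ? _].
rewrite big_ord_recl -[leLHS]adde0; apply: leeD; last by do 2![apply: sume_ge0 => ? _].
rewrite big_mkcond big_ord_recl/= -[leLHS]adde0; apply: leeD => //.
by apply: sume_ge0 => ? _; case: ifP.
Qed.

Lemma convolution_cell_continuous (X Y Z : grid R) (sigma : R)
    (f : generalized_function R) (i j k : nat) :
  - (1 / 2) < sigma -> sobolev sigma f ->
  continuous (convolution (cell_chi X Y Z i j k) f).
Proof.
move=> sigma_gt; have chiE := @cell_chi_box X Y Z i j k.
case: f => [u|F] /= [s0].
  move=> [D /sobolev_jet_L2[mu_ u2]].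
  exact: convolution_function_continuous chiE _ mu_ u2.
move=> dF; apply: convolution_functional_continuous chiE _ _ _ dF.
by apply/andP; split; lra.
Qed.

End ConvolutionOfCells.

(** * Energy estimate for the difference scheme *)

Section OneDimensionalSums.
Variables (R : realType) (W : grid R).
Local Notation n := (nsub W).
Local Notation x := (node W).
Local Notation h := (step W).
Local Notation hb := (hbar W).

Lemma nsub_gt0 : (0 < n)%N.
Proof.
rewrite lt0n; apply/eqP => n0; have := node_last W.
by rewrite n0 node_first => /eqP; rewrite eq_sym oner_eq0.
Qed.

Lemma step_gt0 i : (0 < i <= n)%N -> 0 < h i.
Proof. by case: i => // i /andP[_ ?]; rewrite /step subr_gt0 node_lt. Qed.

Lemma hbar_gt0 i : (0 < i < n)%N -> 0 < hb i.
Proof.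
move=> /andP[i0 i1]; rewrite /hbar divr_gt0// addr_gt0// step_gt0//.
by rewrite i0 ltnW.
Qed.

Lemma node_le i j : (i <= j <= n)%N -> x i <= x j.
Proof.
move=> /andP[ij jn]; elim: j ij jn => [|j IH]; first by rewrite leqn0 => /eqP->.
rewrite leq_eqVlt ltnS => /orP[/eqP->//|ij jn].
by rewrite (le_trans (IH ij (ltnW jn)))// ltW// node_lt.
Qed.

Lemma node_itv i : (i <= n)%N -> 0 <= x i <= 1.
Proof.
by move=> ni; rewrite -(node_first W) -(node_last W) !node_le// ?leqnn ?ni.
Qed.

Lemma summation_by_parts (a b : nat -> R) :
  \sum_(1 <= i < n) (a i.+1 - a i) * b i +
  \sum_(1 <= i < n.+1) a i * (b i - b i.-1) = a n * b n - a 1%N * b 0%N.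
Proof.
have := nsub_gt0; case: n => // m _; elim: m => [|m IH].
  by rewrite big_geq// big_nat1/=; ring.
rewrite big_nat_recr//= (big_nat_recr m.+2)//=.
have -> : \sum_(1 <= i < m.+1) (a i.+1 - a i) * b i =
    a m.+1 * b m.+1 - a 1%N * b 0%N - \sum_(1 <= i < m.+2) a i * (b i - b i.-1).
  by rewrite -IH addrK.
by ring.
Qed.

Definition neighbour_sum (e : nat -> R) i : R := h i * e i.-1 + h i.+1 * e i.+1.

(** Collecting by nodes, e_l receives h_l from its left neighbour and h_(l+1) from its right one,
    together 2 hbar_l. Nodes next to the boundary miss one contribution, hence the inequality. *)
Lemma neighbour_sum_le (e : nat -> R) : (forall i, 0 <= e i) ->
  e 0%N = 0 -> e n = 0 ->
  \sum_(1 <= i < n) neighbour_sum e i <= \sum_(1 <= i < n) 2 * hb i * e i.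
Proof.
move=> e_ge0 e0 en.
(* An exact identity for every upper limit, boundary terms included, is what induction can carry. *)
suff E m : (0 < m)%N -> \sum_(1 <= i < m) neighbour_sum e i =
    \sum_(1 <= i < m) 2 * hb i * e i + h 1%N * e 0%N + h m * e m
      - h 1%N * e 1%N - h m * e m.-1.
  have n0 := nsub_gt0; rewrite E// e0 en !mulr0 !addr0 -addrA gerDl.
  have h1 : 0 < h 1%N by rewrite step_gt0// n0.
  have hn : 0 < h n by rewrite step_gt0// n0 leqnn.
  by rewrite -opprD oppr_le0 addr_ge0// mulr_ge0// ltW.
elim: m => // -[_ _|m IH _]; first by rewrite !big_geq//=; ring.
rewrite big_nat_recr//= IH// [in RHS]big_nat_recr//= /neighbour_sum /hbar/=.
by field.
Qed.

(** Cauchy-Schwarz for a telescoping sum with weights [h l], whose total is x_i - x_m; it is proved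
    by moving the right end. *)
Lemma increment_sq_le (c : nat -> R) m i : (m <= i <= n)%N ->
  (c i - c m) ^+ 2 <=
    (x i - x m) * \sum_(m.+1 <= l < i.+1) (c l - c l.-1) ^+ 2 / h l.
Proof.
move=> /andP[mi]; rewrite -(subnK mi) addnC.
elim: (i - m)%N => [|d IH] dn.
  by rewrite addn0 !subrr big_geq// mul0r expr0n.
rewrite addnS in dn *; have {IH} := IH (ltnW dn).
rewrite (@big_nat_recr _ _ _ (m + d).+1 m.+1) ?ltnS ?leq_addr//=.
set s := \sum_(_ <= _ < _) _; set j := (m + d)%N in dn *.
have hj : 0 < h j.+1 by rewrite step_gt0.
have xj : x j.+1 = x j + h j.+1 by rewrite /step/= addrC subrK.
have mj : 0 <= x j - x m by rewrite subr_ge0 node_le// leq_addr ltnW.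
have s0 : 0 <= s.
  rewrite /s big_nat_cond sumr_ge0// => l /andP[/andP[lm lj] _].
  rewrite divr_ge0 ?sqr_ge0// ltW// step_gt0// (leq_ltn_trans (leq0n m) lm)/=.
  by rewrite -ltnS (leq_trans lj)// ltnS ltnW.
rewrite xj; move: (h j.+1) hj => H H0.
have -> : c j.+1 - c m = (c j - c m) + (c j.+1 - c j) by ring.
move: (c j - c m) (c j.+1 - c j) => a b.
have -> : x j + H - x m = (x j - x m) + H by ring.
move: (x j - x m) mj => y y0 ays.
(* with [a^2 <= y s], AM-GM gives [2 a b <= y b^2 / H + H s] *)
have -> : (y + H) * (s + b ^+ 2 / H) = y * s + y * b ^+ 2 / H + H * s + b ^+ 2.
  by field; rewrite gt_eqF.
suff : 2 * (a * b) <= y * b ^+ 2 / H + H * s by nra.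
have yb0 : 0 <= y * b ^+ 2 / H 
  by apply: divr_ge0; [apply: mulr_ge0 => //; exact: sqr_ge0|exact: ltW].
have Hs0 : 0 <= H * s by rewrite mulr_ge0// ltW.
apply: (@le_trans _ _ `|2 * (a * b)|); first exact: ler_norm.
rewrite -(ler_pXn2r (ltn0Sn 1)) ?nnegrE ?addr_ge0//.
rewrite real_normK ?num_real//.
have : (a * b) ^+ 2 <= (y * b ^+ 2 / H) * (H * s).
  have -> : (y * b ^+ 2 / H) * (H * s) = (y * s) * b ^+ 2 by field; rewrite gt_eqF.
  by rewrite exprMn ler_wpM2r ?sqr_ge0.
move: (y * b ^+ 2 / H) (H * s) (a * b) => A B t tAB.
by have := sqr_ge0 (A - B); nra.
Qed.

(** The trapezoidal rule underestimates the integral of a concave function, and x (1 - x) has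
    integral 1/6. *)
Lemma trapezoid_le : \sum_(1 <= i < n) hb i * (x i * (1 - x i)) <= 1 / 6.
Proof.
(* Partial rule on [0, x_m]: the last node gets half a cell only, and the right side is the
   primitive x^2/2 - x^3/3. Each new cell leaves a slack of H^3/6. *)
suff E m : (0 < m <= n)%N ->
    \sum_(1 <= i < m) hb i * (x i * (1 - x i)) + h m * (x m * (1 - x m)) / 2 <=
      x m ^+ 2 / 2 - x m ^+ 3 / 3.
  have := E n; rewrite nsub_gt0 leqnn node_last => /(_ isT).
  by rewrite subrr !mulr0 mul0r addr0 !expr1n; lra.
elim: m => // -[_ n1|m IH mn].
  rewrite big_geq// add0r /step/= node_first subr0.
  have /andP[x0 _] := node_itv n1.
  by have := mulr_ge0 x0 (sqr_ge0 (x 1%N)); nra.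
rewrite big_nat_recr//=; have := IH (ltnW mn).
have hm : 0 < h m.+2 by rewrite step_gt0.
have xm : x m.+2 = x m.+1 + h m.+2 by rewrite /step/= addrC subrK.
rewrite /hbar xm; move: (h m.+2) hm (h m.+1) (x m.+1) => H H0 K y.
have := mulr_ge0 (ltW H0) (sqr_ge0 H); nra.
Qed.

Lemma poincare1 (c : nat -> R) : c 0%N = 0 -> c n = 0 ->
  \sum_(1 <= i < n) hb i * c i ^+ 2 <=
    1 / 6 * \sum_(1 <= i < n.+1) h i * `|(c i - c i.-1) / h i| ^+ 2.
Proof.
move=> c0 cn.
pose S i j := \sum_(i.+1 <= l < j.+1) (c l - c l.-1) ^+ 2 / h l.
have SE : \sum_(1 <= i < n.+1) h i * `|(c i - c i.-1) / h i| ^+ 2 = S 0%N n.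
  apply: eq_big_nat => i /andP[i0 ni].
  have hi : 0 < h i by rewrite step_gt0// i0 -ltnS.
  by rewrite real_normK ?num_real//; field; rewrite gt_eqF.
rewrite SE.
have S0 : 0 <= S 0%N n.
  rewrite /S big_nat_cond sumr_ge0// => l /andP[/andP[l0 ln] _].
  by rewrite divr_ge0 ?sqr_ge0// ltW// step_gt0// l0 -ltnS.
apply: (@le_trans _ _ (\sum_(1 <= i < n) hb i * (x i * (1 - x i)) * S 0%N n)).
  apply: ler_sum_nat => i /andP[i0 ni].
  have hi : 0 < hb i by rewrite hbar_gt0// i0.
  rewrite -mulrA ler_wpM2l ?(ltW hi)//.
  have L := @increment_sq_le c 0 i; have M := @increment_sq_le c i n.
  rewrite leq0n (ltnW ni) c0 node_first !subr0 in L.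
  rewrite leqnn (ltnW ni) cn node_last sub0r sqrrN in M.
  have {L}L := L isT; have {M}M := M isT.
  have -> : S 0%N n = S 0%N i + S i n.
    by rewrite /S (big_cat_nat _ (n := i.+1))// ltnS ltnW.
  have /andP[x0 x1] := node_itv (ltnW ni).
  rewrite -/(S 0%N i) in L; rewrite -/(S i n) in M.
  move: (S 0%N i) (S i n) (c i ^+ 2) L M => s t C L M.
  (* The bounds from the two ends, C <= x s and C <= (1 - x) t, are weighted by 1 - x and x and
     added, giving C <= x (1 - x) (s + t). *)
  have := ler_wpM2l x0 M; have := @ler_wpM2l _ (1 - x i) _ _ _ L.
  by rewrite subr_ge0 => /(_ x1); nra.
by rewrite -mulr_suml ler_wpM2r// trapezoid_le.
Qed.

End OneDimensionalSums.

(** * Coercivity of the averages *)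

Section Averages.
Variables (R : realType) (Y Z : grid R).

Definition average (w : nat -> nat -> R) (j k : nat) : R :=
  muyz Y Z (fun=> w) 0 j k.

(** The four corner weights add up to 4 hbar hbar. AM-GM costs half of 4/16 at the centre, leaving
    12/16 - 2/16 = 10/16, and 1/32 of the corner squares, whose sum [N] is at most 4 times the
    central one: 10/16 - 4/32 = 1/2. *)
Lemma average_coercive (w : nat -> nat -> R) :
  (forall k, w 0%N k = 0) -> (forall k, w (nsub Y) k = 0) ->
  (forall j, w j 0%N = 0) -> (forall j, w j (nsub Z) = 0) ->
  1 / 2 * (\sum_(1 <= j < nsub Y) \sum_(1 <= k < nsub Z)
    hbar Y j * hbar Z k * w j k ^+ 2) <=
  \sum_(1 <= j < nsub Y) \sum_(1 <= k < nsub Z)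
    hbar Y j * hbar Z k * (average w j k * w j k).
Proof.
move=> w0k wnk wj0 wjn.
pose e j k := w j k ^+ 2.
pose N j k := neighbour_sum Z (fun k' => neighbour_sum Y (e ^~ k') j) k.
have N_le : \sum_(1 <= j < nsub Y) \sum_(1 <= k < nsub Z) N j k <=
    \sum_(1 <= j < nsub Y) \sum_(1 <= k < nsub Z) 4 * (hbar Y j * hbar Z k * e j k).
  (* [N] is a neighbour sum in z of neighbour sums in y, so the one-dimensional bound applies twice
     and gives the factor 2 * 2. *)
  apply: (@le_trans _ _ (\sum_(1 <= j < nsub Y) \sum_(1 <= k < nsub Z)
      2 * hbar Z k * neighbour_sum Y (e ^~ k) j)).
    apply: ler_sum_nat => j /andP[j0 jn]; apply: neighbour_sum_le.
    - move=> k; rewrite /neighbour_sum addr_ge0// mulr_ge0 ?sqr_ge0// ltW//.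
        by rewrite step_gt0// j0 ltnW.
      by rewrite step_gt0.
    - by rewrite /neighbour_sum /e !wj0 expr0n/= !mulr0 addr0.
    - by rewrite /neighbour_sum /e !wjn expr0n/= !mulr0 addr0.
  rewrite exchange_big_nat/= [leRHS]exchange_big_nat/=.
  apply: ler_sum_nat => k kn; rewrite -mulr_sumr.
  have hk : 0 <= 2 * hbar Z k by rewrite mulr_ge0// ltW// hbar_gt0.
  apply: (@le_trans _ _ (2 * hbar Z k * \sum_(1 <= j < nsub Y) 2 * hbar Y j * e j k)).
    rewrite ler_wpM2l//.
    apply: (@neighbour_sum_le R Y (e ^~ k)).
    - by move=> j; rewrite sqr_ge0.
    - by rewrite /e w0k expr0n.
    - by rewrite /e wnk expr0n.
  by rewrite mulr_sumr; apply: ler_sum_nat => j _; rewrite le_eqVlt; apply/orP; left;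
    apply/eqP; ring.
have pointwise : \sum_(1 <= j < nsub Y) \sum_(1 <= k < nsub Z)
    (10 / 16 * (hbar Y j * hbar Z k * e j k) - 1 / 32 * N j k) <=
  \sum_(1 <= j < nsub Y) \sum_(1 <= k < nsub Z)
    hbar Y j * hbar Z k * (average w j k * w j k).
  apply: ler_sum_nat => j jn; apply: ler_sum_nat => k kn.
  have hj := hbar_gt0 jn; have hk := hbar_gt0 kn.
  have [/andP[j0 jn'] /andP[k0 kn']] := (jn, kn).
  have a0 : 0 < step Y j by rewrite step_gt0// j0 ltnW.
  have a1 : 0 < step Y j.+1 by rewrite step_gt0.
  have b0 : 0 < step Z k by rewrite step_gt0// k0 ltnW.
  have b1 : 0 < step Z k.+1 by rewrite step_gt0.
  have corner_le (c z t : R) : 0 < c -> - (c * (z ^+ 2 + t ^+ 2)) / 2 <= c * z * t.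
    by move=> c0; have := mulr_ge0 (ltW c0) (sqr_ge0 (z + t)); nra.
  have -> : hbar Y j * hbar Z k * (average w j k * w j k) =
      (step Y j * step Z k * w j.-1 k.-1 * w j k
       + step Y j.+1 * step Z k * w j.+1 k.-1 * w j k
       + 12 * hbar Y j * hbar Z k * w j k ^+ 2
       + step Y j * step Z k.+1 * w j.-1 k.+1 * w j k
       + step Y j.+1 * step Z k.+1 * w j.+1 k.+1 * w j k) / 16.
    by rewrite /average /muyz; field; rewrite !gt_eqF.
  have := corner_le _ (w j.-1 k.-1) (w j k) (mulr_gt0 a0 b0).
  have := corner_le _ (w j.+1 k.-1) (w j k) (mulr_gt0 a1 b0).
  have := corner_le _ (w j.-1 k.+1) (w j k) (mulr_gt0 a0 b1).
  have := corner_le _ (w j.+1 k.+1) (w j k) (mulr_gt0 a1 b1).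
  rewrite /N /e /neighbour_sum /hbar; lra.
apply: le_trans pointwise.
have -> : \sum_(1 <= j < nsub Y) \sum_(1 <= k < nsub Z)
    (10 / 16 * (hbar Y j * hbar Z k * e j k) - 1 / 32 * N j k) =
    10 / 16 * \sum_(1 <= j < nsub Y) \sum_(1 <= k < nsub Z) hbar Y j * hbar Z k * e j k
    - 1 / 32 * \sum_(1 <= j < nsub Y) \sum_(1 <= k < nsub Z) N j k.
  by rewrite !mulr_sumr -sumrB; apply: eq_bigr => j _; rewrite !mulr_sumr -sumrB.
have E4 : \sum_(1 <= j < nsub Y) \sum_(1 <= k < nsub Z)
    4 * (hbar Y j * hbar Z k * e j k) =
    4 * \sum_(1 <= j < nsub Y) \sum_(1 <= k < nsub Z) hbar Y j * hbar Z k * e j k.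
  by rewrite mulr_sumr; apply: eq_bigr => j _; rewrite mulr_sumr.
by move: N_le; rewrite E4 /e; lra.
Qed.

End Averages.

Section TripleSums.
Variables (R : realType) (nx ny nz : nat) (F : nat -> nat -> nat -> R).
Variables (mx my mz : nat).

Lemma sum3_213 :
  \sum_(mx <= i < nx) \sum_(my <= j < ny) \sum_(mz <= k < nz) F i j k =
  \sum_(my <= j < ny) \sum_(mx <= i < nx) \sum_(mz <= k < nz) F i j k.
Proof. by rewrite exchange_big_nat. Qed.

Lemma sum3_312 :
  \sum_(mx <= i < nx) \sum_(my <= j < ny) \sum_(mz <= k < nz) F i j k =
  \sum_(mz <= k < nz) \sum_(mx <= i < nx) \sum_(my <= j < ny) F i j k.
Proof.
rewrite [RHS]exchange_big_nat; apply: eq_bigr => i _.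
by rewrite exchange_big_nat.
Qed.

End TripleSums.

(** * Energy along one axis *)

Section DirectionalEnergy.
Variables (R : realType) (X Y Z : grid R) (v : nat -> nat -> nat -> R).
Hypothesis v_bdry : forall i j k, ~ interior_index X Y Z i j k -> v i j k = 0.

Lemma directional_energy :
  \sum_(1 <= i < (nsub X).+1) \sum_(1 <= j < nsub Y) \sum_(1 <= k < nsub Z)
    step X i * hbar Y j * hbar Z k * `|Dmx X v i j k| ^+ 2 <=
  \sum_(1 <= i < nsub X) \sum_(1 <= j < nsub Y) \sum_(1 <= k < nsub Z)
    hbar X i * hbar Y j * hbar Z k *
      (- 2 * Dpx X (Dmx X (muyz Y Z v)) i j k) * v i j k.
Proof.
have v_out i j k : (i == 0) || (i == nsub X) || (j == 0) || (j == nsub Y)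
    || (k == 0) || (k == nsub Z) -> v i j k = 0.
  move=> out; apply: v_bdry => -[/andP[i0 i1] /andP[j0 j1] /andP[k0 k1]].
  by move: out; rewrite (gtn_eqF i0) (gtn_eqF j0) (gtn_eqF k0) (ltn_eqF i1)
    (ltn_eqF j1) (ltn_eqF k1).
pose D i j k := Dmx X v i j k.
(* True for every [i], as [v] vanishes on the whole x-line, so [average_coercive] applies on each
   slice. *)
have D_bdry i j k : (j == 0) || (j == nsub Y) || (k == 0) || (k == nsub Z) ->
    D i j k = 0.
  move=> out; have v0 l : v l j k = 0.
    by apply: v_out; rewrite -2!orbA; move: out; rewrite -!orbA => ->; rewrite !orbT.
  by rewrite /D /Dmx !v0 subrr mul0r.
(* Averaging in y and z commutes with differencing in x. After summation by parts the average
   therefore acts on the same [D i] that it is paired with. *)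
have DmuE i j k : Dmx X (muyz Y Z v) i j k = average Y Z (D i) j k.
  by rewrite /average /D /muyz /Dmx /muyz; ring.
have parts j k : \sum_(1 <= i < nsub X) hbar X i * hbar Y j * hbar Z k *
      (- 2 * Dpx X (Dmx X (muyz Y Z v)) i j k) * v i j k =
    \sum_(1 <= i < (nsub X).+1) 2 * step X i *
      (hbar Y j * hbar Z k * (average Y Z (D i) j k * D i j k)).
  have := summation_by_parts X (fun i => average Y Z (D i) j k) (fun i => v i j k).
  rewrite !v_out ?eqxx ?orbT// !mulr0 subrr => /eqP; rewrite addr_eq0 => /eqP E.
  transitivity (- 2 * (hbar Y j * hbar Z k) * \sum_(1 <= i < nsub X)
      (average Y Z (D i.+1) j k - average Y Z (D i) j k) * v i j k).
    rewrite mulr_sumr; apply: eq_big_nat => i ni; have hi := hbar_gt0 ni.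
    by rewrite /Dpx !DmuE; field; rewrite gt_eqF.
  rewrite E mulrN -mulNr mulr_sumr; apply: eq_big_nat => i /andP[i0 ni].
  have hi : 0 < step X i by rewrite step_gt0// i0.
  by rewrite /D /Dmx; field; rewrite gt_eqF.
rewrite [leRHS]sum3_213.
under [leRHS]eq_bigr do rewrite exchange_big_nat/=.
under [leRHS]eq_bigr do under eq_bigr do rewrite parts.
rewrite [leRHS]sum3_312; apply: ler_sum_nat => i /andP[i0 ni].
have hi : 0 < step X i by rewrite step_gt0// i0.
have := @average_coercive R Y Z (D i) _ _ _ _.
move=> /(_ _ _ _ _)/(ler_wpM2l (ltW hi)) coercive.
have {}coercive : step X i * (1 / 2 * (\sum_(1 <= j < nsub Y) \sum_(1 <= k < nsub Z)
      hbar Y j * hbar Z k * D i j k ^+ 2)) <=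
    step X i * (\sum_(1 <= j < nsub Y) \sum_(1 <= k < nsub Z)
      hbar Y j * hbar Z k * (average Y Z (D i) j k * D i j k)).
  by apply: coercive => l; apply: D_bdry; rewrite eqxx ?orbT.
have -> : \sum_(1 <= j < nsub Y) \sum_(1 <= k < nsub Z)
      step X i * hbar Y j * hbar Z k * `|Dmx X v i j k| ^+ 2 =
    step X i * \sum_(1 <= j < nsub Y) \sum_(1 <= k < nsub Z)
      hbar Y j * hbar Z k * D i j k ^+ 2.
  rewrite mulr_sumr; apply: eq_bigr => j _; rewrite mulr_sumr; apply: eq_bigr => k _.
  by rewrite real_normK ?num_real// !mulrA.
have -> : \sum_(1 <= j < nsub Y) \sum_(1 <= k < nsub Z)
      2 * step X i * (hbar Y j * hbar Z k * (average Y Z (D i) j k * D i j k)) =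
    2 * (step X i * \sum_(1 <= j < nsub Y) \sum_(1 <= k < nsub Z)
      hbar Y j * hbar Z k * (average Y Z (D i) j k * D i j k)).
  rewrite mulrA mulr_sumr; apply: eq_bigr => j _; rewrite mulr_sumr.
  by apply: eq_bigr.
(* The factor 2 of the scheme compensates the 1/2 of [average_coercive]. *)
by move: coercive; rewrite mulrCA; lra.
Qed.

Lemma directional_poincare :
  \sum_(1 <= i < nsub X) \sum_(1 <= j < nsub Y) \sum_(1 <= k < nsub Z)
    hbar X i * hbar Y j * hbar Z k * v i j k * v i j k <=
  1 / 6 * \sum_(1 <= i < (nsub X).+1) \sum_(1 <= j < nsub Y) \sum_(1 <= k < nsub Z)
    step X i * hbar Y j * hbar Z k * `|Dmx X v i j k| ^+ 2.
Proof.
rewrite sum3_213 [in leRHS]sum3_213 mulr_sumr; apply: ler_sum_nat => j jn.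
rewrite exchange_big_nat/= [in leRHS]exchange_big_nat/= mulr_sumr.
apply: ler_sum_nat => k kn.
have hjk : 0 <= hbar Y j * hbar Z k by rewrite mulr_ge0// ltW// hbar_gt0.
have v0 : v 0%N j k = 0 by apply: v_bdry => -[].
have vn : v (nsub X) j k = 0 by apply: v_bdry => -[]; rewrite ltnn andbF.
have := ler_wpM2l hjk (@poincare1 R X (fun i => v i j k) v0 vn).
rewrite !mulr_sumr => P1.
apply: (le_trans (le_trans _ P1)).
  by apply: ler_sum => i _; rewrite le_eqVlt; apply/orP; left; apply/eqP; ring.
by apply: ler_sum => i _; rewrite le_eqVlt /Dmx; apply/orP; left; apply/eqP; ring.
Qed.

End DirectionalEnergy.

Section MeshEnergy.
Variables (R : realType) (X Y Z : grid R).

Definition mesh_operator (v : nat -> nat -> nat -> R) (i j k : nat) : R :=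
  - 2 * (Dpx X (Dmx X (muyz Y Z v)) i j k + Dpy Y (Dmy Y (muxz X Z v)) i j k
         + Dpz Z (Dmz Z (muxy X Y v)) i j k).

Variable v : nat -> nat -> nat -> R.
Hypothesis v_bdry : forall i j k, ~ interior_index X Y Z i j k -> v i j k = 0.

Let v_bdry_y j i k : ~ interior_index Y X Z j i k -> v i j k = 0.
Proof. by move=> out; apply: v_bdry => -[i1 j1 k1]; apply: out. Qed.

Let v_bdry_z k i j : ~ interior_index Z X Y k i j -> v i j k = 0.
Proof. by move=> out; apply: v_bdry => -[i1 j1 k1]; apply: out. Qed.

(** The three directions are one estimate with the axes permuted: for the permuted family [muyz]
    becomes [muxz] or [muxy]. *)
Lemma mesh_energy : mesh_semi_sqnorm X Y Z v <= mesh_inner X Y Z (mesh_operator v) v.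
Proof.
have -> : mesh_inner X Y Z (mesh_operator v) v =
    \sum_(1 <= i < nsub X) \sum_(1 <= j < nsub Y) \sum_(1 <= k < nsub Z)
      hbar X i * hbar Y j * hbar Z k *
        (- 2 * Dpx X (Dmx X (muyz Y Z v)) i j k) * v i j k +
    \sum_(1 <= j < nsub Y) \sum_(1 <= i < nsub X) \sum_(1 <= k < nsub Z)
      hbar Y j * hbar X i * hbar Z k *
        (- 2 * Dpy Y (Dmy Y (muxz X Z v)) i j k) * v i j k +
    \sum_(1 <= k < nsub Z) \sum_(1 <= i < nsub X) \sum_(1 <= j < nsub Y)
      hbar Z k * hbar X i * hbar Y j *
        (- 2 * Dpz Z (Dmz Z (muxy X Y v)) i j k) * v i j k.
  rewrite [X in _ = _ + X + _]sum3_213 [X in _ = _ + X]sum3_312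
    [X in _ = _ + X]sum3_312 -!big_split; apply: eq_bigr => i _.
  rewrite -!big_split; apply: eq_bigr => j _; rewrite -!big_split; apply: eq_bigr => k _.
  by rewrite /mesh_operator/=; ring.
rewrite /mesh_semi_sqnorm; apply: lerD; [apply: lerD|].
- exact: directional_energy.
- have := @directional_energy R Y X Z (fun j i k => v i j k) v_bdry_y.
  apply: le_trans; rewrite [leRHS]sum3_213 le_eqVlt; apply/orP; left; apply/eqP.
  apply: eq_bigr => i _; apply: eq_bigr => j _; apply: eq_bigr => k _.
  by rewrite /Dmy /Dmx mulrCA !mulrA mulrC !mulrA; ring.
- have := @directional_energy R Z X Y (fun k i j => v i j k) v_bdry_z.
  apply: le_trans; rewrite [leRHS]sum3_312 [leRHS]sum3_312 le_eqVlt; apply/orP; left; apply/eqP.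
  apply: eq_bigr => i _; apply: eq_bigr => j _; apply: eq_bigr => k _.
  by rewrite /Dmz /Dmx; ring.
Qed.

(** Each direction alone bounds the same left side with constant 1/6; adding the three and dividing
    by 3 gives 1/18. *)
Lemma mesh_poincare : mesh_inner X Y Z v v <= 1 / 18 * mesh_semi_sqnorm X Y Z v.
Proof.
have Px := directional_poincare v_bdry.
have Py := @directional_poincare R Y X Z (fun j i k => v i j k) v_bdry_y.
have Pz := @directional_poincare R Z X Y (fun k i j => v i j k) v_bdry_z.
rewrite [leLHS]sum3_213 [X in _ <= _ * X]sum3_213 in Py.
rewrite 2![leLHS]sum3_312 2![X in _ <= _ * X]sum3_312 in Pz.
rewrite /mesh_semi_sqnorm.
have innerE G : (forall i j k, G i j k =
      hbar X i * hbar Y j * hbar Z k * v i j k * v i j k) ->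
    \sum_(1 <= i < nsub X) \sum_(1 <= j < nsub Y) \sum_(1 <= k < nsub Z) G i j k =
    mesh_inner X Y Z v v.
  by move=> GE; apply: eq_bigr => i _; apply: eq_bigr => j _; apply: eq_bigr => k _.
rewrite innerE in Px; last by [].
rewrite innerE in Py; last by move=> i j k; ring.
rewrite innerE in Pz; last by move=> i j k; ring.
have sumE nx ny nz F G : (forall i j k, F i j k = G i j k :> R) ->
    \sum_(1 <= i < nx) \sum_(1 <= j < ny) \sum_(1 <= k < nz) F i j k =
    \sum_(1 <= i < nx) \sum_(1 <= j < ny) \sum_(1 <= k < nz) G i j k.
  by move=> FG; apply: eq_bigr => i _; apply: eq_bigr => j _; apply: eq_bigr.
rewrite (sumE _ _ _ _ (fun i j k =>
  hbar X i * step Y j * hbar Z k * `|Dmy Y v i j k| ^+ 2)) in Py; last first.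
  by move=> i j k; rewrite /Dmy /Dmx; ring.
rewrite (sumE _ _ _ _ (fun i j k =>
  hbar X i * hbar Y j * step Z k * `|Dmz Z v i j k| ^+ 2)) in Pz; last first.
  by move=> i j k; rewrite /Dmz /Dmx; ring.
by lra.
Qed.

End MeshEnergy.

(** * Stability and unique solvability *)

Section MeshNorms.
Variables (R : realType) (X Y Z : grid R).
Implicit Types (v w g : nat -> nat -> nat -> R) (u : mesh_function X Y Z).
Local Notation inner := (mesh_inner X Y Z).
Local Notation semi := (mesh_semi_sqnorm X Y Z).
Local Notation H1norm := (mesh_H1norm X Y Z).
Local Notation hb3 i j k := (hbar X i * hbar Y j * hbar Z k).

Lemma nodal_out u : vanishing u ->
  forall i j k, ~ interior_index X Y Z i j k -> nodal u i j k = 0.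
Proof.
(* An index out of range is sent to 0 by [inord], hence to the boundary; a positive value certifies
   that the index was in range. *)
have inordK_pos m i : (0 < (inord i : 'I_m.+1))%N -> (inord i : 'I_m.+1) = i :> nat.
  have [im|im] := leqP i m; first by rewrite inordK.
  rewrite [inord i](_ : _ = ord0)//; apply: val_inj.
  by rewrite /= val_insubd ltnS leqNgt im.
move=> u0 i j k out; apply: u0 => -[] /[dup] /andP[/inordK_pos -> _] i1.
move=> /[dup] /andP[/inordK_pos -> _] j1 /[dup] /andP[/inordK_pos -> _] k1.
exact: out.
Qed.

Lemma ler_term_sum_nat m n (F : nat -> R) i : (m <= i < n)%N ->
  (forall l, (m <= l < n)%N -> 0 <= F l) -> F i <= \sum_(m <= l < n) F l.
Proof.
move=> imn F0; rewrite (bigD1_seq i) ?mem_index_iota ?iota_uniq//=.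
by rewrite lerDl big_seq_cond sumr_ge0// => l /andP[]; rewrite mem_index_iota => /F0.
Qed.

Lemma sum_nat_ge0 m n (F : nat -> R) :
  (forall l, (m <= l < n)%N -> 0 <= F l) -> 0 <= \sum_(m <= l < n) F l.
Proof. by move=> F0; rewrite big_nat_cond sumr_ge0// => l /andP[/F0]. Qed.

Lemma hb3_gt0 i j k : interior_index X Y Z i j k -> 0 < hb3 i j k.
Proof. by move=> [? ? ?]; apply: mulr_gt0; [apply: mulr_gt0|]; exact: hbar_gt0. Qed.

Lemma ler_term_sum3 (F : nat -> nat -> nat -> R) i j k :
  interior_index X Y Z i j k ->
  (forall i j k, interior_index X Y Z i j k -> 0 <= F i j k) ->
  F i j k <= \sum_(1 <= i < nsub X) \sum_(1 <= j < nsub Y) \sum_(1 <= k < nsub Z) F i j k.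
Proof.
move=> [ix iy iz] F0.
apply: le_trans (ler_term_sum_nat (F := F i j) iz _) _ => [l lz|]; first exact: F0.
apply: le_trans (ler_term_sum_nat
  (F := fun j => \sum_(1 <= k < nsub Z) F i j k) iy _) _ => [l ly|].
  by apply: sum_nat_ge0 => m mz; exact: F0.
apply: (ler_term_sum_nat
  (F := fun i => \sum_(1 <= j < nsub Y) \sum_(1 <= k < nsub Z) F i j k) ix) => l lx.
by do 2![apply: sum_nat_ge0 => ? ?]; exact: F0.
Qed.

Lemma inner_term_ge0 v i j k : interior_index X Y Z i j k ->
  0 <= hb3 i j k * v i j k * v i j k.
Proof. by move=> /hb3_gt0/ltW h; rewrite -mulrA -expr2 mulr_ge0 ?sqr_ge0. Qed.

Lemma inner_ge0 v : 0 <= inner v v.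
Proof.
apply: sum_nat_ge0 => i ix; apply: sum_nat_ge0 => j jx; apply: sum_nat_ge0 => k kx.
exact: inner_term_ge0.
Qed.

Lemma inner_ge_term v i j k : interior_index X Y Z i j k ->
  hb3 i j k * v i j k ^+ 2 <= inner v v.
Proof.
move=> ijk; rewrite expr2 mulrA.
exact: (ler_term_sum3 (F := fun i j k => hb3 i j k * v i j k * v i j k) ijk
  (@inner_term_ge0 v)).
Qed.

Lemma H1norm_sqr v : (forall i j k, ~ interior_index X Y Z i j k -> v i j k = 0) ->
  H1norm v ^+ 2 = inner v v + semi v.
Proof.
move=> v0; rewrite sqr_sqrtr// addr_ge0 ?inner_ge0//.
by have := mesh_poincare v0; have := inner_ge0 v; lra.
Qed.

Lemma H1norm_le_operator v :
  (forall i j k, ~ interior_index X Y Z i j k -> v i j k = 0) ->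
  H1norm v ^+ 2 <= 16 / 15 * inner (mesh_operator X Y Z v) v.
Proof.
move=> v0; rewrite H1norm_sqr//.
by have := mesh_poincare v0; have := mesh_energy v0; have := inner_ge0 v; lra.
Qed.

(** Needed because [sup] is an upper bound only for a set bounded above. A crude constant is enough:
    each weighted nodal value is at most the whole norm. *)
Lemma inner_bounded g : exists2 B : R, 0 <= B &
  forall v, (forall i j k, ~ interior_index X Y Z i j k -> v i j k = 0) ->
    `|inner g v| <= B * H1norm v.
Proof.
exists (\sum_(1 <= i < nsub X) \sum_(1 <= j < nsub Y) \sum_(1 <= k < nsub Z)
    Num.sqrt (hb3 i j k) * `|g i j k|).
  by do 3![apply: sum_nat_ge0 => ? ?]; rewrite mulr_ge0 ?sqrtr_ge0.
move=> v v0; rewrite /mesh_inner.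
apply: le_trans (ler_norm_sum _ _ _) _; rewrite mulr_suml; apply: ler_sum_nat => i ix.
apply: le_trans (ler_norm_sum _ _ _) _; rewrite mulr_suml; apply: ler_sum_nat => j jx.
apply: le_trans (ler_norm_sum _ _ _) _; rewrite mulr_suml; apply: ler_sum_nat => k kx.
have h0 : 0 < hb3 i j k by exact: hb3_gt0.
rewrite 2!normrM (gtr0_norm h0).
rewrite -[X in X * _ * _ <= _](sqr_sqrtr (ltW h0)).
have -> : Num.sqrt (hb3 i j k) ^+ 2 * `|g i j k| * `|v i j k| =
  Num.sqrt (hb3 i j k) * `|g i j k| * (Num.sqrt (hb3 i j k) * `|v i j k|) by ring.
rewrite ler_wpM2l ?mulr_ge0 ?sqrtr_ge0//.
rewrite -(ler_pXn2r (ltn0Sn 1)) ?nnegrE ?mulr_ge0 ?sqrtr_ge0// H1norm_sqr//.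
rewrite exprMn sqr_sqrtr ?(ltW h0)// real_normK ?num_real//.
have := inner_ge_term v (And3 ix jx kx).
by have := mesh_poincare v0; have := inner_ge0 v; lra.
Qed.

Lemma dual_norm_ubound g (w : mesh_function X Y Z) : vanishing w -> w != 0 ->
  `|inner g (nodal w)| / H1norm (nodal w) <= mesh_dual_norm X Y Z g.
Proof.
move=> w0 wn0; apply: ub_le_sup; last by exists w.
have [B B0 gB] := inner_bounded g; exists B => _ [u [u0 _] <-].
have [->|n0] := eqVneq (H1norm (nodal u)) 0; first by rewrite invr0 mulr0.
have n1 : 0 < H1norm (nodal u) by rewrite lt_neqAle eq_sym n0 sqrtr_ge0.
by rewrite ler_pdivrMr// gB//; exact: nodal_out.
Qed.

Lemma dual_norm_ge0 g : 0 <= mesh_dual_norm X Y Z g.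
Proof.
rewrite /mesh_dual_norm; set S := (X in sup X).
have [->|/set0P[_ [w [w0 wn0] _]]] := eqVneq S set0; first by rewrite sup0.
by apply: le_trans (dual_norm_ubound g w0 wn0); rewrite divr_ge0 ?sqrtr_ge0.
Qed.

Lemma eq_inner g g' v : (forall i j k, interior_index X Y Z i j k -> g i j k = g' i j k) ->
  inner g v = inner g' v.
Proof.
move=> gg; apply: eq_big_nat => i ix; apply: eq_big_nat => j jx.
by apply: eq_big_nat => k kx; rewrite gg.
Qed.

(** Testing with u itself gives |u|^2 <= 16/15 (g, u) <= 16/15 |g| |u| in the respective norms, and
    division by a nonzero |u| concludes. *)
Lemma stability (g : nat -> nat -> nat -> R) u : vanishing u ->
  (forall i j k, interior_index X Y Z i j k ->
    mesh_operator X Y Z (nodal u) i j k = g i j k) ->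
  H1norm (nodal u) <= 32 / 30 * mesh_dual_norm X Y Z g.
Proof.
move=> u0 opg; have D0 := dual_norm_ge0 g; have v0 := nodal_out u0.
have [->|n0] := eqVneq (H1norm (nodal u)) 0; first by rewrite mulr_ge0.
have n1 : 0 < H1norm (nodal u) by rewrite lt_neqAle eq_sym n0 sqrtr_ge0.
have un0 : u != 0.
  apply: contra_neq n0 => u_0.
  have nod0 : forall i j k, nodal u i j k = 0 by move=> i j k; rewrite u_0 /nodal ffunE.
  apply/eqP; rewrite -sqrf_eq0 eq_le sqr_ge0 andbT.
  apply: le_trans (H1norm_le_operator v0) _.
  rewrite (_ : inner _ _ = 0) ?mulr0//.
  by rewrite /mesh_inner !big1// => i _; rewrite big1// => j _; rewrite big1// => k _;
    rewrite nod0 mulr0.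
have := H1norm_le_operator v0; rewrite (eq_inner _ opg) => le1.
have := dual_norm_ubound g u0 un0; rewrite ler_pdivrMr//.
have := ler_norm (inner g (nodal u)) => le2 le3.
rewrite -(ler_pM2r n1) -expr2; lra.
Qed.

End MeshNorms.

(** * Existence from uniqueness *)

Section Solvability.
Variables (R : realType) (X Y Z : grid R).
Local Notation I := ('I_(nsub X).+1 * 'I_(nsub Y).+1 * 'I_(nsub Z).+1)%type.
Local Notation V := {ffun I -> R^o}.

Definition interior (p : I) : bool :=
  [&& (0 < p.1.1 < nsub X)%N, (0 < p.1.2 < nsub Y)%N & (0 < p.2 < nsub Z)%N].

Lemma interiorP (p : I) : reflect (interior_index X Y Z p.1.1 p.1.2 p.2) (interior p).
Proof. exact: and3P. Qed.

(* The identity at boundary nodes makes the linear system square. *)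
Definition scheme (u : V) : V :=
  [ffun p => if interior p then
     mesh_operator X Y Z (@nodal R X Y Z u) p.1.1 p.1.2 p.2 else u p].

Lemma scheme_linear : linear scheme.
Proof.
move=> a u v; apply/ffunP => p; rewrite !ffunE; case: ifP => // _.
rewrite /mesh_operator /Dpx /Dmx /Dpy /Dmy /Dpz /Dmz /muyz /muxz /muxy /nodal !ffunE.
by rewrite /GRing.scale/=; ring.
Qed.

HB.instance Definition _ := GRing.isLinear.Build R V V *:%R scheme scheme_linear.

Lemma nodal_ord (u : mesh_function X Y Z) (p : I) : nodal u p.1.1 p.1.2 p.2 = u p.
Proof. by rewrite /nodal !inord_val; case: p => [[]]. Qed.

(** A zero right side makes the energy zero, and the weight of every interior node is positive, so
    every nodal value vanishes. *)
Lemma scheme_eq0 (u : V) : scheme u = 0 -> u = 0.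
Proof.
move=> Su; have u_out : @vanishing R X Y Z u.
  move=> i j k out; have := congr1 (fun f : V => f (i, j, k)) Su.
  by rewrite !ffunE; case: interiorP.
have v0 := nodal_out u_out.
have op0 i j k : interior_index X Y Z i j k ->
    mesh_operator X Y Z (@nodal R X Y Z u) i j k = 0.
  move=> ijk; have [/andP[_ iX] /andP[_ jY] /andP[_ kZ]] := ijk.
  pose p : I := (inord i, inord j, inord k).
  have pE : (p.1.1 = i :> nat) * (p.1.2 = j :> nat) * (p.2 = k :> nat).
    by rewrite /p/= !inordK// ltnW.
  have := congr1 (fun f : V => f p) Su; rewrite !ffunE.
  by case: interiorP; rewrite !pE.
have n0 : mesh_H1norm X Y Z (@nodal R X Y Z u) ^+ 2 <= 0.
  apply: le_trans (H1norm_le_operator v0) _.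
  rewrite (eq_inner _ op0) (_ : mesh_inner _ _ _ _ _ = 0) ?mulr0//.
  by rewrite /mesh_inner !big1// => i _; rewrite big1// => j _; rewrite big1// => k _;
    rewrite mulr0 mul0r.
apply/ffunP => p; rewrite ffunE -(nodal_ord u).
case: (interiorP p) => [ijk|out]; last exact: v0.
have := @inner_ge_term R X Y Z (@nodal R X Y Z u) _ _ _ ijk.
rewrite H1norm_sqr// in n0.
have s0 := mesh_poincare v0; have i0 := @inner_ge0 R X Y Z (@nodal R X Y Z u).
move=> le_inner; apply/eqP; rewrite -sqrf_eq0 eq_le sqr_ge0 andbT.
by rewrite -(pmulr_rle0 _ (hb3_gt0 ijk)); lra.
Qed.

(** By rank and nullity, an injective endomorphism of the finite-dimensional space [V] is onto. *)
Lemma scheme_bijective (b : V) : exists! u : V, scheme u = b.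
Proof.
pose F : 'End(V) := linfun scheme.
have injS : injective scheme.
  by move=> u v uv; apply/eqP; rewrite -subr_eq0; apply/eqP; apply: scheme_eq0;
    rewrite linearB/= uv subrr.
have kerF : lker F == 0%VS.
  by apply/lker0P => u v; rewrite !lfunE; exact: injS.
have : limg F = fullv.
  apply/eqP; rewrite eqEdim subvf/= limg_dim_eq// (eqP kerF) capv0//.
move/vspaceP/(_ b); rewrite memvf => /memv_imgP[u _ ->].
by exists u; rewrite lfunE; split=> // v /injS.
Qed.

Lemma unique_mesh_solution (g : nat -> nat -> nat -> R) :
  exists! u : mesh_function X Y Z,
    (forall i j k, interior_index X Y Z i j k ->
      mesh_operator X Y Z (nodal u) i j k = g i j k) /\ vanishing u.
Proof.
(* Zero at boundary nodes, where [scheme] is the identity: the single equation [scheme u = b]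
   encodes both the scheme and the boundary condition. *)
pose b : V := [ffun p => if interior p then g p.1.1 p.1.2 p.2 else 0].
have schemeE (u : mesh_function X Y Z) : scheme u = b <->
    (forall i j k, interior_index X Y Z i j k ->
      mesh_operator X Y Z (nodal u) i j k = g i j k) /\ vanishing u.
  split=> [Su|[opu u0]].
    split=> [i j k ijk|i j k out].
      have [/andP[_ iX] /andP[_ jY] /andP[_ kZ]] := ijk.
      pose p : I := (inord i, inord j, inord k).
      have pE : (p.1.1 = i :> nat) * (p.1.2 = j :> nat) * (p.2 = k :> nat).
        by rewrite /p/= !inordK// ltnW.
      have := congr1 (fun f : V => f p) Su; rewrite !ffunE.
      by case: interiorP; rewrite !pE.
    have := congr1 (fun f : V => f (i, j, k)) Su.
    by rewrite !ffunE; case: interiorP.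
  apply/ffunP => p; rewrite !ffunE; case: interiorP => [ijk|out]; first exact: opu.
  by case: p out => [[i j] k] out; exact: u0.
have [u [Su uniq_u]] := scheme_bijective b.
exists u; split; first exact/schemeE.
by move=> v /schemeE /uniq_u.
Qed.

End Solvability.

Unset Implicit Arguments.

Theorem theorem3p2 (R : realType) (X Y Z : grid R) (sigma : R)
    (f : generalized_function R) (sigma_gt : - (1 / 2) < sigma)
    (f_sobolev : sobolev sigma f) :
  (forall i j k : nat, interior_index X Y Z i j k ->
     continuous (convolution (cell_chi X Y Z i j k) f)) /\
  (exists! u : mesh_function X Y Z, solves f u) /\
  (forall u : mesh_function X Y Z, solves f u ->
     mesh_H1norm X Y Z (nodal u) <=
       32 / 30 * mesh_dual_norm X Y Z (T111 X Y Z f)).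
Proof.
split=> [i j k _|]; first exact: convolution_cell_continuous sigma_gt f_sobolev.
split; first exact: unique_mesh_solution.
by move=> u [opu u0]; exact: stability.
Qed.
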